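(* In the Markov modulated model for $n$ obligors described in the context, let $\nu^k_t=\mathbf 1_{\{N_t=k\}}$ for $k=0,\dots,n$, $\nu_t=(\nu^0_t,\dots,\nu^n_t)^\top$, and $\zeta_t=\nu_t\otimes X_t\in\mathbb R^{(n+1)d}$. Then the process $\zeta$ is Markov with transition (intensity) matrix $$\mathbf Q=A\otimes\mathrm{diag}(\lambda)+I\otimes Q .$$ It follows that, for $0\le s\le t$, $\mathbb E[\zeta_t\mid\mathcal F_s]=\exp(\mathbf Q(t-s))\,\zeta_s$.
   Context: Model. $X$ is a continuous-time Markov chain with values in the set $\{e_1,\dots,e_d\}$ of standard basis vectors of $\mathbb R^d$, with irreducible transition matrix $Q\in\mathbb R^{d\times d}$; convention: $Q_{ij}$, $i\neq j$, is the intensity of a transition from state $j$ to state $i$, so column sums of $Q$ are zero and $\mathrm dX_t=QX_t\,\mathrm dt+\mathrm dM^X_t$ with $M^X$ a martingale. Let $\lambda\in\mathbb R^d_+$. There are $n$ default times $\tau^1,\dots,\tau^n$ which, conditionally on the whole process $X$, are independent with $\mathbb P(\tau^i>t\mid\mathcal F^X)=\exp(-\int_0^t\lambda^\top X_s\,\mathrm ds)$. Put $Y^i_t=\mathbf 1_{\{\tau^i\le t\}}$ and $N_t=\sum_{i=1}^nY^i_t$ (so $N_0=0$). Then $\mathrm dN_t=\lambda^\top X_t(n-N_t)\,\mathrm dt+\mathrm dm_t$ with $m$ a martingale, and $X$ and $N$ have a.s. no simultaneous jumps. $(\mathcal F_t)$ is the filtration generated by $X$ and $Y^1,\dots,Y^n$.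 $A\in\mathbb R^{(n+1)\times(n+1)}$, with rows and columns indexed by $0,\dots,n$, has $A_{kk}=-(n-k)$ for $0\le k\le n$, $A_{k,k-1}=n-k+1$ for $1\le k\le n$, and all other entries zero. $\mathrm{diag}(\lambda)$ is the diagonal matrix with diagonal $\lambda$, $\otimes$ is the Kronecker product, and $I$ is the identity matrix of size $n+1$. For the chain $\zeta$ (with values in the standard basis vectors of $\mathbb R^{(n+1)d}$) the same column convention for transition matrices is used. *)

(* Defs.v *)
From HB Require Import structures.
From mathcomp Require Import all_boot all_order all_algebra.
From mathcomp Require Import all_classical all_reals all_analysis.
From mathcomp Require Import measurable_realfun.
From mathcomp Require Import mxtens.

Set Implicit Arguments.
Unset Strict Implicit.
Unset Printing Implicit Defensive.

Import Order.TTheory GRing.Theory Num.Theory.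
Import numFieldNormedType.Exports.

Local Open Scope classical_set_scope.
Local Open Scope ring_scope.

Definition expmx (R : realType) (m : nat) (M : 'M[R]_m) : 'M[R]_m :=
  limn (series (fun k : nat => k`!%:R^-1 *: M ^+ k)).

Section conditional_expectation.
Context (R : realType) (disp : measure_display) (T : measurableType disp).
Variable P : probability T R.

Definition sub_sigma_algebra (G : set (set T)) : Prop :=
  sigma_algebra setT G /\ G `<=` measurable.

(* Z is a version of E[X | G] *)
Definition is_cond_expectation (G : set (set T)) (X Z : T -> R) : Prop :=
  [/\ sub_sigma_algebra G,
      P.-integrable setT (EFin \o X),
      preimage_set_system setT Z measurable `<=` G,
      P.-integrable setT (EFin \o Z) &
      forall A, G A ->
        (\int[P]_(w in A) (X w)%:E = \int[P]_(w in A) (Z w)%:E)%E].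

Definition is_cond_prob (G : set (set T)) (E : set T) (p : T -> R) : Prop :=
  is_cond_expectation G (\1_E) p.

(* Mutual conditional independence given G.  Subfamilies are covered by taking
   B i = setT for the indices that are left out. *)
Definition cond_independent (G : set (set T)) (n : nat)
    (tau : 'I_n -> T -> \bar R) : Prop :=
  forall (B : 'I_n -> set (\bar R)) (p : 'I_n -> T -> R),
    (forall i, measurable (B i)) ->
    (forall i, is_cond_prob G (tau i @^-1` B i) (p i)) ->
    is_cond_prob G (\bigcap_(i in setT) (tau i @^-1` B i))
                   (fun w => \prod_i p i w).

End conditional_expectation.

(* Processes are indexed by all of R, but only times t >= 0 are ever used. *)

(* the events {Z_u^i \in B}, for u in D, B Borel and i a coordinate *)
Definition process_events (R : realType) (T : Type) (m : nat) (D : set R)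
    (Z : R -> T -> 'cV[R]_m) : set (set T) :=
  \bigcup_(u in D) \bigcup_(i in [set: 'I_m])
    preimage_set_system setT (fun w => Z u w i 0) measurable.

Definition natural_filtration (R : realType) (T : Type) (m : nat)
    (Z : R -> T -> 'cV[R]_m) (t : R) : set (set T) :=
  <<s process_events `[0, t] Z >>.

Definition natural_filtration2 (R : realType) (T : Type) (m n : nat)
    (Z : R -> T -> 'cV[R]_m) (Y : R -> T -> 'cV[R]_n) (t : R) : set (set T) :=
  <<s process_events `[0, t] Z `|` process_events `[0, t] Y >>.

(* information generated by the whole path *)
Definition sigma_path (R : realType) (T : Type) (m : nat)
    (Z : R -> T -> 'cV[R]_m) : set (set T) :=
  <<s process_events `[0, +oo[ Z >>.

(* Column convention: p t i j is the probability of going from j to i in time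
   t, and Q i j, for i != j, is the intensity of a transition from j to i. *)
Definition transition_function (R : realType) (m : nat)
    (p : R -> 'M[R]_m) (Q : 'M[R]_m) : Prop :=
  [/\ forall (t : R) i j, 0 <= t -> 0 <= p t i j,
      forall (t : R) j, 0 <= t -> \sum_i p t i j = 1,
      p 0 = 1%:M,
      forall s t : R, 0 <= s -> 0 <= t -> p (s + t) = p s *m p t &
      h^-1 *: (p h - 1%:M) @[h --> 0^'+] --> Q].

(* Z is a cadlag time-homogeneous Markov chain, with respect to the filtration
   F, on the standard basis vectors, with intensity matrix Q.  As (Z_t)_i is
   the indicator of {Z_t = e_i}, the last condition reads
   P(Z_t = e_i | F_s) = p (t - s) i j on {Z_s = e_j}; with s = t it contains
   the adaptedness of Z to F. *)
Definition is_markov_chain (R : realType) (disp : measure_display)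
    (T : measurableType disp) (P : probability T R)
    (F : R -> set (set T)) (m : nat) (Z : R -> T -> 'cV[R]_m)
    (Q : 'M[R]_m) : Prop :=
  [/\ forall (t : R) w, 0 <= t -> exists i : 'I_m, Z t w = delta_mx i 0,
      forall (t : R) w, 0 <= t -> Z u w @[u --> t^'+] --> Z t w,
      forall (t : R) w, 0 < t -> cvg (Z u w @[u --> t^'-]) &
      exists2 p : R -> 'M[R]_m, transition_function p Q &
        forall (s t : R) (i : 'I_m), 0 <= s -> s <= t ->
          is_cond_expectation P (F s) (fun w => Z t w i 0)
            (fun w => (p (t - s) *m Z s w) i 0)].

Definition irreducible_intensity (R : realType) (m : nat) (Q : 'M[R]_m) :
    Prop :=
  forall i j : 'I_m, connect (fun k l => (k != l) && (0 < Q l k)) i j.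

Section default_counting.
Context (R : realType) (T : Type) (n : nat).
Variable tau : 'I_n -> T -> \bar R.

Definition default_indicators (t : R) (w : T) : 'cV[R]_n :=
  \col_i (tau i w <= t%:E)%E%:R.

Definition default_count (t : R) (w : T) : R :=
  \sum_i default_indicators t w i 0.

Definition default_state (t : R) (w : T) : 'cV[R]_n.+1 :=
  \col_k (default_count t w == k%:R)%:R.

End default_counting.

Definition default_matrix (R : realType) (n : nat) : 'M[R]_n.+1 :=
  \matrix_(k, l) (if k == l then - (n - k)%:R
                  else if (k == l.+1 :> nat) then (n - k + 1)%:R else 0).

(* Main.v *)
Require Import Defs.
From HB Require Import structures.
From mathcomp Require Import all_boot all_order all_algebra.
From mathcomp Require Import all_classical all_reals all_analysis.
From mathcomp Require Import measurable_realfun.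
From mathcomp Require Import mxtens.
From mathcomp Require Import ring lra.

Set Implicit Arguments.
Unset Strict Implicit.
Unset Printing Implicit Defensive.

Import Order.TTheory GRing.Theory Num.Theory.
Import numFieldNormedType.Exports.

Local Open Scope classical_set_scope.
Local Open Scope ring_scope.

(* Conditionally on the path of X the default times are i.i.d. with cumulative
   hazard Lam, so for an event B of F_s determined by the path of X up to s and
   by constraints {tau^j <= r_j}, r_j <= s, the vector E[1_B zeta_t] equals
   g t = E[W psi(Lam_t) (x) X_t] for t >= s.  Here W is F^X_s-measurable, and
   psi a is the law of the number of defaults at cumulative hazard a, so that
   psi' = A psi.  Using only the Markov property of X, together with
   Lam_(u+h) - Lam_u = h lam^T X_u + o(h) in L^1 uniformly in u, one gets
   g (u + h) = (1 + h QQ) g u + o(h) uniformly in u, whence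
   g t = exp((t - s) QQ) g s.  Such B form a pi-system generating F_s. *)

(** * Euler steps and the matrix exponential *)

Section euler.
Context (R : realType).

(** On a fixed path [X] jumps, so [Lam_(u+h) - Lam_u - h lam^T X_u] is not o(h) uniformly in u. Its
    L^1 norm is, because by homogeneity the mean displacement of the chain over a time h is bounded
    through its transition function alone. Uniformity is what allows one-step errors to be summed
    over an Euler mesh. The default times are removed by conditioning on the whole path: the event
    that the set of defaulted obligors at t is K factorises over obligors, and summing over the sets
    K of size k gives a binomial law. Obligors constrained by tau^j <= r_j have defaulted by s; they
    contribute only a factor to W, and psi counts them as defaulted while the remaining ones are at
    risk. What is left involves X alone. There the derivative of psi(Lam) produces the random rate
    lam^T X_u, which equals lam_i where X_u = e_i; this is the origin of the diagonal matrix in the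
    generator. That exp(t QQ) is a stochastic semigroup needs a proof as well; its positivity comes
    from the same Euler scheme, whose small steps preserve nonnegative vectors. *)

Definition l1norm m (v : 'cV[R]_m) : R := \sum_i `|v i 0|.

(** Only an upper bound of the operator norm for [l1norm]; summing all entries makes it dominate
    diagonal entries and row sums as well. *)
Definition l1opnorm m (M : 'M[R]_m) : R := \sum_i \sum_j `|M i j|.

Lemma l1norm_ge0 m (v : 'cV[R]_m) : 0 <= l1norm v.
Proof. exact: sumr_ge0. Qed.

Lemma l1opnorm_ge0 m (M : 'M[R]_m) : 0 <= l1opnorm M.
Proof. by apply: sumr_ge0 => i _; exact: sumr_ge0. Qed.

Lemma l1norm_ge m (v : 'cV[R]_m) i : `|v i 0| <= l1norm v.
Proof. by rewrite /l1norm (bigD1 i)//= lerDl sumr_ge0. Qed.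

Lemma l1norm0 m : l1norm (0 : 'cV[R]_m) = 0.
Proof. by rewrite /l1norm big1// => i _; rewrite mxE normr0. Qed.

Lemma l1normD m (v w : 'cV[R]_m) : l1norm (v + w) <= l1norm v + l1norm w.
Proof.
by rewrite -big_split/=; apply: ler_sum => i _; rewrite mxE ler_normD.
Qed.

Lemma l1normZ m a (v : 'cV[R]_m) : l1norm (a *: v) = `|a| * l1norm v.
Proof. by rewrite mulr_sumr; apply: eq_bigr => i _; rewrite mxE normrM. Qed.

Lemma l1norm_mulmx m (M : 'M[R]_m) (v : 'cV[R]_m) :
  l1norm (M *m v) <= l1opnorm M * l1norm v.
Proof.
rewrite /l1opnorm mulr_suml; apply: ler_sum => i _.
rewrite mxE mulr_suml (le_trans (ler_norm_sum _ _ _))//.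
by apply: ler_sum => j _; rewrite normrM ler_wpM2l// l1norm_ge.
Qed.

Definition euler_step m (M : 'M[R]_m) (h : R) (v : 'cV[R]_m) : 'cV[R]_m :=
  v + h *: (M *m v).

(* phi' = M phi in the weak form that the one-step Euler error is o(h) uniformly
   on [0, T].  Unlike differentiability this is easily checked for expectations,
   and it still determines phi from phi 0, as the limit of the Euler scheme. *)
Definition flow m (M : 'M[R]_m) (T : R) (phi : R -> 'cV[R]_m) : Prop :=
  forall e, 0 < e -> exists2 d, 0 < d & forall u h, 0 <= u -> 0 < h -> h < d ->
    u + h <= T -> l1norm (phi (u + h) - euler_step M h (phi u)) <= e * h.

Lemma euler_stepB m (M : 'M[R]_m) (h : R) (v w : 'cV[R]_m) :
  euler_step M h v - euler_step M h w = euler_step M h (v - w).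
Proof. by rewrite /euler_step mulmxBr scalerBr opprD addrACA. Qed.

(** The factor [1 + C * h] is relaxed to an exponential so that successive steps multiply into
    [expR (C * T)], however many there are. *)
Lemma l1norm_euler_step m (M : 'M[R]_m) (h : R) (v : 'cV[R]_m) : 0 <= h ->
  l1norm (euler_step M h v) <= expR (l1opnorm M * h) * l1norm v.
Proof.
move=> h0; apply: (le_trans (l1normD _ _)); rewrite l1normZ ger0_norm//.
apply: (@le_trans _ _ ((1 + l1opnorm M * h) * l1norm v)).
  by rewrite mulrDl mul1r lerD2l mulrAC mulrC ler_wpM2r// l1norm_mulmx.
by rewrite ler_wpM2r ?l1norm_ge0// expR_ge1Dx.
Qed.

(** A discrete Gronwall argument: local errors [eps * h] add up, each amplified by at most
    [expR (C * T)]. The lower bound [N0] lets a caller force a finer mesh. *)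
Lemma euler_scheme m (M : 'M[R]_m) (T : R) (phi : R -> 'cV[R]_m) :
  0 <= T -> flow M T phi -> forall N0 e, 0 < e ->
  exists2 N, (N0 < N)%N &
    l1norm (phi T - iter N (euler_step M (T / N%:R)) (phi 0)) <= e.
Proof.
rewrite le_eqVlt => /predU1P[<- _ N0 e e0|T0 phiM N0 e e0].
  exists N0.+1 => //; suff -> : iter N0.+1 (euler_step M (0 / N0.+1%:R)) (phi 0) = phi 0.
    by rewrite subrr l1norm0 ltW.
  by rewrite mul0r; elim: N0.+1 => //= k ->; rewrite /euler_step scale0r addr0.
set C := l1opnorm M; have C0 : 0 <= C by exact: l1opnorm_ge0.
(* Chosen so that the accumulated bound [eps * T * expR (C * T)] equals [e]. *)
pose eps := e / (T * expR (C * T)).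
have eps0 : 0 < eps by rewrite divr_gt0// mulr_gt0// expR_gt0.
have [d d0 phid] := phiM _ eps0.
pose N := (Num.bound (T / d) + N0).+1.
have N_gt0 : 0 < N%:R :> R by rewrite ltr0n.
exists N; first by rewrite ltnS leq_addl.
set h := T / N%:R.
have h0 : 0 < h by rewrite divr_gt0.
have hd : h < d.
  rewrite /h ltr_pdivrMr// mulrC -ltr_pdivrMr//.
  rewrite (lt_trans (archi_boundP _)) ?divr_ge0 ?ltW//.
  by rewrite ltr_nat ltnS leq_addr.
have hN : h * N%:R = T by rewrite /h divfK// gt_eqF.
have /(_ N (leqnn _)) : forall k, (k <= N)%N ->
  l1norm (phi (h * k%:R) - iter k (euler_step M h) (phi 0)) <=
  eps * (h * k%:R) * expR (C * (h * k%:R)).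
  elim=> [_|k IH kN].
    by rewrite /= !mulr0 subrr l1norm0 mul0r.
  rewrite iterS -natr1 mulrDr mulr1.
  set x := iter k _ _ in IH *; set t := h * k%:R in IH *.
  have t0 : 0 <= t by rewrite mulr_ge0// ltW.
  (* Splits the new error into the local error of one step and the old error carried through an
     Euler step. *)
  rewrite -[phi _](subrK (euler_step M h (phi t))) -addrA euler_stepB.
  apply: (le_trans (l1normD _ _)).
  have H1 : l1norm (phi (t + h) - euler_step M h (phi t)) <= eps * h.
    apply: phid => //; rewrite -hN /t -[X in _ + X]mulr1 -mulrDr natr1.
    by rewrite ler_pM2l// ler_nat.
  have H2 : l1norm (euler_step M h (phi t - x)) <=
      expR (C * h) * (eps * t * expR (C * t)).
    apply: (le_trans (l1norm_euler_step _ _ (ltW h0))).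
    by rewrite ler_wpM2l ?expR_ge0// IH// ltnW.
  apply: (le_trans (lerD H1 H2)).
  rewrite [expR (C * h) * _]mulrCA -expRD -mulrDr (addrC h t) [eps * (t + h)]mulrDr.
  rewrite mulrDl [leLHS]addrC lerD2l.
  rewrite ler_peMr//; first by rewrite mulr_ge0// ltW.
  by rewrite -expR0 ler_expR mulr_ge0// addr_ge0// ltW.
rewrite hN => /le_trans; apply; rewrite -mulrA /eps divfK//.
by rewrite gt_eqF// mulr_gt0// expR_gt0.
Qed.

Lemma l1normB m (v w : 'cV[R]_m) : l1norm (v - w) <= l1norm v + l1norm w.
Proof.
by rewrite (le_trans (l1normD _ _))// -scaleN1r l1normZ normrN1 mul1r.
Qed.

(** By linearity the difference of two flows is a flow; its Euler iterates from 0 are all 0, so it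
    is arbitrarily small at [T]. *)
Lemma flow_unique m (M : 'M[R]_m) (T : R) (phi psi : R -> 'cV[R]_m) :
  0 <= T -> flow M T phi -> flow M T psi -> phi 0 = psi 0 -> phi T = psi T.
Proof.
move=> T0 fphi fpsi phipsi.
have fB : flow M T (fun t => phi t - psi t).
  move=> e e0; have e20 : 0 < e / 2 by rewrite divr_gt0.
  have [d1 d10 h1] := fphi _ e20; have [d2 d20 h2] := fpsi _ e20.
  exists (Num.min d1 d2); first by rewrite lt_min d10.
  move=> u h u0 h0; rewrite lt_min => /andP[hd1 hd2] uhT.
  rewrite -euler_stepB [X in _ + X]opprD addrACA -[X in _ + X]opprD (le_trans (l1normB _ _))//.
  by rewrite [e]splitr mulrDl lerD// ?h1// h2.
apply/eqP; rewrite -subr_eq0; apply/eqP/matrixP => i j; rewrite ord1 [RHS]mxE.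
apply/eqP; rewrite -normr_eq0 eq_le normr_ge0 andbT; apply/ler_addgt0Pl => e e0.
rewrite addr0; have [N _] := euler_scheme T0 fB 0 e0.
have -> : iter N (euler_step M (T / N%:R)) (phi 0 - psi 0) = 0.
  rewrite phipsi subrr; move: (T / N%:R) => h; elim: N => //= k ->.
  by rewrite /euler_step mulmx0 scaler0 addr0.
by rewrite subr0; apply: le_trans; exact: l1norm_ge.
Qed.

(** The coefficient of [v i 0] is [1 + h * M i i], nonnegative once [h * l1opnorm M <= 1]. *)
Lemma euler_step_ge0 m (M : 'M[R]_m) (h : R) (v : 'cV[R]_m) :
  0 <= h -> h * l1opnorm M <= 1 -> (forall i j, i != j -> 0 <= M i j) ->
  (forall i, 0 <= v i 0) -> forall i, 0 <= euler_step M h v i 0.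
Proof.
move=> h0 hM M0 v0 i; rewrite !mxE (bigD1 i)//= mulrDr addrA addr_ge0//; last first.
  rewrite mulr_ge0// sumr_ge0// => j ji.
  by rewrite mulr_ge0// M0// eq_sym.
rewrite mulrA -[X in X + _]mul1r -mulrDl mulr_ge0//.
rewrite -lerBlDl sub0r lerNl (le_trans _ hM)// -mulrN ler_wpM2l//.
rewrite /l1opnorm (bigD1 i)//= (bigD1 i)//= -addrA.
rewrite -[leLHS]addr0 lerD//; first by rewrite -normrN ler_norm.
by rewrite addr_ge0// sumr_ge0// => k _; exact: sumr_ge0.
Qed.

Lemma flow_ge0 m (M : 'M[R]_m) (T : R) (phi : R -> 'cV[R]_m) :
  0 <= T -> flow M T phi -> (forall i j, i != j -> 0 <= M i j) ->
  (forall i, 0 <= phi 0 i 0) -> forall i, 0 <= phi T i 0.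
Proof.
move=> T0 fphi M0 phi0 i; apply/ler_addgt0Pl => e e0.
(* More than [T * l1opnorm M] steps, so that [euler_step_ge0] applies with mesh [T / N]. *)
have [N NT] := euler_scheme T0 fphi (Num.bound (T * l1opnorm M)) e0.
set x := iter _ _ _ => /(le_trans (l1norm_ge _ i)).
have x0 : 0 <= x i 0.
  rewrite /x; rewrite /x; elim: {1}N i => //= k IH i; apply: euler_step_ge0 => //.
    by rewrite divr_ge0.
  rewrite mulrAC ler_pdivrMr ?ltr0n ?(leq_ltn_trans _ NT)// mul1r.
  rewrite (le_trans (ltW (archi_boundP _))) ?mulr_ge0 ?l1opnorm_ge0//.
  by rewrite ler_nat ltnW.
rewrite !mxE ler_norml => /andP[+ _]; lra.
Qed.

(** The mean value theorem is used twice, for a Lipschitz bound on [phi] and then for the remainder.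
    [K] is uniform over [[0, T]] so that the estimate can be applied with random endpoints [a] and
    [b]. *)
Lemma mean_value_taylor m (M : 'M[R]_m) (phi : R -> 'cV[R]_m) :
  (forall (t : R) i, is_derive t (1 : R) (fun t : R => phi t i 0) ((M *m phi t) i 0)) ->
  forall T : R, 0 <= T -> exists2 K : R, 0 <= K & forall a b : R, 0 <= a -> a <= b -> b <= T ->
    l1norm (phi b - euler_step M (b - a) (phi a)) <= K * (b - a) ^+ 2.
Proof.
move=> dphi T T0; set C := l1opnorm M; have C0 : 0 <= C by exact: l1opnorm_ge0.
have cphi i : continuous (fun t => phi t i 0).
  move=> t; have dt := dphi t i.
  exact/differentiable_continuous/derivable1_diffP.
have cl1 : continuous (fun t => l1norm (phi t)).
  by apply: continuous_big => [|i _ t]; [exact: add_continuous|apply: cvg_norm; exact: cphi].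
have [c _ cB] := @EVT_max R _ 0 T T0 (continuous_subspaceT cl1).
set B := l1norm (phi c); have B0 : 0 <= B := l1norm_ge0 _.
have MVTphi i a b : 0 <= a -> a <= b -> b <= T ->
    exists2 x, a <= x <= b & phi b i 0 - phi a i 0 = (M *m phi x) i 0 * (b - a).
  move=> a0 ab bT.
  have [x xab ->] := @MVT_segment R (fun t => phi t i 0)
    (fun t => (M *m phi t) i 0) a b ab (fun x _ => dphi x i)
    (continuous_subspaceT (cphi i)).
  by exists x => //; move: xab; rewrite in_itv.
have lip a b : 0 <= a -> a <= b -> b <= T ->
    l1norm (phi b - phi a) <= m%:R * (C * B * (b - a)).
  move=> a0 ab bT; rewrite /l1norm mulr_natl -[X in _ *+ X]card_ord -sumr_const.
  apply: ler_sum => i _; rewrite !mxE; have [x /andP[ax xb] ->] := MVTphi i a b a0 ab bT.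
  rewrite normrM [`|b - a|]ger0_norm ?subr_ge0// ler_wpM2r ?subr_ge0//.
  rewrite (le_trans (l1norm_ge _ i))// (le_trans (l1norm_mulmx _ _))//.
  rewrite ler_wpM2l// cB// in_itv/= (le_trans a0)//=; lra.
(* One factor [m] comes from summing coordinates in the Lipschitz bound, the other from summing the
   remainders. *)
exists (m%:R * (C * (m%:R * (C * B)))); first by rewrite !mulr_ge0.
move=> a b a0 ab bT; rewrite /l1norm -!mulrA mulr_natl -[X in _ *+ X]card_ord -sumr_const.
apply: ler_sum => i _; rewrite /euler_step.
have [x /andP[ax xb] eqx] := MVTphi i a b a0 ab bT.
have -> : (phi b - (phi a + (b - a) *: (M *m phi a))) i 0 =
    (M *m (phi x - phi a)) i 0 * (b - a).
  transitivity (phi b i 0 - phi a i 0 - (b - a) * (M *m phi a) i 0).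
    by rewrite !mxE opprD addrA.
  by rewrite eqx mulmxBr !mxE; ring.
rewrite normrM [`|b - a|]ger0_norm ?subr_ge0//.
rewrite (le_trans (ler_wpM2r _ (l1norm_ge _ i))) ?subr_ge0//.
rewrite (le_trans (ler_wpM2r _ (l1norm_mulmx _ _))) ?subr_ge0// -/C.
have /(ler_wpM2l C0) := lip a x a0 ax (le_trans xb bT).
move=> /(ler_wpM2r (_ : 0 <= b - a)); rewrite subr_ge0 => /(_ ab) /le_trans; apply.
rewrite expr2 !mulrA ler_wpM2r ?subr_ge0// -!mulrA.
by do 4! (rewrite ler_wpM2l//); rewrite lerB.
Qed.

Lemma derive_flow m (M : 'M[R]_m) (phi : R -> 'cV[R]_m) (T : R) : 0 <= T ->
  (forall (t : R) i, is_derive t (1 : R) (fun t : R => phi t i 0) ((M *m phi t) i 0)) ->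
  flow M T phi.
Proof.
move=> T0 /mean_value_taylor /(_ T T0) [K K0 HK] e e0.
exists (e / (K + 1)); first by rewrite divr_gt0// ltr_wpDl.
move=> u h u0 h0 hd uhT.
have := HK u (u + h) u0; rewrite addrAC subrr add0r lerDl => /(_ (ltW h0) uhT).
move=> /le_trans; apply; rewrite expr2 mulrA ler_wpM2r// ?ltW//.
move: hd; rewrite ltr_pdivlMr ?ltr_wpDl// => hd.
by rewrite (le_lt_trans _ hd)// mulrC ler_wpM2l ?ltW// ltrDl.
Qed.

End euler.

Lemma cvg_mx (R : realType) (T : Type) (F : set_system T) (m n : nat)
    (f : T -> 'M[R]_(m, n)) (l : 'M[R]_(m, n)) : Filter F ->
  (forall i j, f x i j @[x --> F] --> l i j) -> f x @[x --> F] --> l.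
Proof.
move=> FF fl A [B lB BA]; rewrite nbhs_simpl.
have : \forall x \near F, forall ij : 'I_m * 'I_n, B ij.1 ij.2 (f x ij.1 ij.2).
  by apply: filter_forall => -[i j]; apply: fl; exact: lB.
by apply: filterS => x Bx; apply: BA => i j; exact: (Bx (i, j)).
Qed.

(** * The matrix exponential as an entrywise power series and as a semigroup *)

Section expmx.
Context (R : realType) (m : nat).
Implicit Type M : 'M[R]_m.

(** The entry is a coordinate of [M ^+ k] applied to a basis vector, and each factor multiplies the
    [l1norm] by at most [l1opnorm M]. *)
Lemma normr_exprmx M k i j : `|(M ^+ k) i j| <= l1opnorm M ^+ k.
Proof.
have : l1norm (M ^+ k *m delta_mx j 0 : 'cV_m) <= l1opnorm M ^+ k.
  elim: k => [|k IH].
    rewrite !expr0 mul1mx /l1norm (bigD1 j)//= mxE !eqxx normr1 big1 ?addr0//.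
    by move=> l /negPf lj; rewrite mxE lj normr0.
  rewrite exprS -mulmxE -mulmxA (le_trans (l1norm_mulmx _ _))// exprS.
  by rewrite ler_wpM2l// l1opnorm_ge0.
apply: le_trans; rewrite -colE; have -> : (M ^+ k) i j = col j (M ^+ k) i 0 by rewrite mxE.
exact: l1norm_ge.
Qed.

Lemma exprmxZ M (t : R) k : (t *: M) ^+ k = t ^+ k *: M ^+ k.
Proof.
elim: k => [|k IH]; first by rewrite !expr0 scale1r.
by rewrite !exprS IH -!mulmxE -scalemxAl -scalemxAr scalerA.
Qed.

Lemma normr_mulmx_exprmx M (N : 'M[R]_m) k i j :
  `|(N *m M ^+ k) i j| <= l1opnorm N * l1opnorm M ^+ k.
Proof.
rewrite mxE (le_trans (ler_norm_sum _ _ _))//.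
rewrite /l1opnorm mulr_suml [leRHS](bigD1 i)//= -[leLHS]addr0 lerD//; last first.
  apply: sumr_ge0 => l _; rewrite mulr_ge0 ?sumr_ge0// exprn_ge0//.
  exact: l1opnorm_ge0.
rewrite mulr_suml; apply: ler_sum => l _.
by rewrite normrM ler_wpM2l// normr_exprmx.
Qed.

(** Coefficients in [t] of an entry of [N *m expmx (t *: M)]. The factor [N] closes the family under
    formal differentiation, which merely replaces it by [N *m M]. *)
Definition expmx_coef M (N : 'M[R]_m) i j (k : nat) : R :=
  k`!%:R^-1 * (N *m M ^+ k) i j.

Lemma is_cvg_expmx_coef M N i j (x : R) : cvgn (pseries (expmx_coef M N i j) x).
Proof.
apply: normed_cvg; rewrite /normed_series_of /=.
set C := l1opnorm N.
apply: (@series_le_cvg _ _ (fun k => C * exp_coeff (l1opnorm M * `|x|) k)).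
- by move=> k; exact: normr_ge0.
- move=> k; rewrite mulr_ge0 ?l1opnorm_ge0// divr_ge0// exprn_ge0// mulr_ge0//.
  exact: l1opnorm_ge0.
- move=> k; rewrite /expmx_coef /exp_coeff/= !normrM normrX exprMn.
  rewrite ger0_norm ?invr_ge0// [leRHS]mulrA [leRHS]mulrC -mulrA.
  by rewrite ler_wpM2l ?invr_ge0// mulrA ler_wpM2r ?exprn_ge0// normr_mulmx_exprmx.
- exact/is_cvg_seriesZ/is_cvg_series_exp_coeff.
Qed.

Lemma pseries_diffs_expmx_coef M N i j :
  pseries_diffs (expmx_coef M N i j) = expmx_coef M (N *m M) i j.
Proof.
apply/funext => k; rewrite /pseries_diffs /expmx_coef factS natrM invfM.
by rewrite exprS -mulmxE mulmxA !mulrA divff ?mul1r// pnatr_eq0.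
Qed.

Lemma is_derive_expmx_coef M N i j (x : R) :
  is_derive x (1 : R) (fun x : R => limn (pseries (expmx_coef M N i j) x))
    (limn (pseries (expmx_coef M (N *m M) i j) x)).
Proof.
rewrite -pseries_diffs_expmx_coef.
(* Termwise differentiation asks that the series and its first two formal derivatives converge at a
   point beyond [|x|]; the radius being infinite, [|x| + 1] will do. *)
apply: (@pseries_snd_diffs _ _ (`|x| + 1)).
- exact: is_cvg_expmx_coef.
- rewrite pseries_diffs_expmx_coef; exact: is_cvg_expmx_coef.
- rewrite !pseries_diffs_expmx_coef; exact: is_cvg_expmx_coef.
- by rewrite [ltRHS]ger0_norm ?ltrDl// addr_ge0.
Qed.

(** Links the matrix limit defining [expmx] to scalar power series: that limit is computed
    entrywise, and multiplying by [N] is a finite sum of such limits. *)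
Lemma cvg_expmx M N (t : R) i j :
  pseries (expmx_coef M N i j) t n @[n --> \oo] --> (N *m expmx (t *: M)) i j.
Proof.
have E n k l : series (fun k : nat => k`!%:R^-1 *: (t *: M) ^+ k) n k l =
    pseries (expmx_coef M 1%:M k l) t n.
  rewrite /series /pseries/= summxE; apply: eq_bigr => r _.
  by rewrite exprmxZ mxE mxE /expmx_coef mul1mx -mulrA [_ * t ^+ r]mulrC.
have cvgE k l : series (fun k : nat => k`!%:R^-1 *: (t *: M) ^+ k) n k l @[n --> \oo]
    --> expmx (t *: M) k l.
  pose L : 'M[R]_m := \matrix_(i, j) limn (pseries (expmx_coef M 1%:M i j) t).
  have -> : expmx (t *: M) = L.
    apply/cvg_lim; first exact: norm_hausdorff.
    apply: cvg_mx => i' j'; under eq_cvg do rewrite E.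
    by rewrite mxE; exact: is_cvg_expmx_coef.
  under eq_cvg do rewrite E.
  by rewrite mxE; exact: is_cvg_expmx_coef.
rewrite mxE.
have -> : pseries (expmx_coef M N i j) t = fun n =>
    \sum_k N i k * series (fun k : nat => k`!%:R^-1 *: (t *: M) ^+ k) n k j.
  apply/funext => n; under [RHS]eq_bigr do rewrite E mulr_sumr.
  rewrite /pseries /series /= exchange_big/=; apply: eq_bigr => r _.
  rewrite /expmx_coef mxE mulrAC mulr_sumr; apply: eq_bigr => k _.
  by rewrite mul1mx; ring.
apply: cvg_big; first exact: add_continuous.
by move=> k _; apply: cvgMr; exact: cvgE.
Qed.

Lemma expmxE M (t : R) i j :
  expmx (t *: M) i j = limn (pseries (expmx_coef M 1%:M i j) t).
Proof. by rewrite -[expmx _]mul1mx; apply/esym/cvg_lim => //; exact: cvg_expmx. Qed.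

Lemma is_derive_expmx M (t : R) i j :
  is_derive t (1 : R) (fun t : R => expmx (t *: M) i j) ((M *m expmx (t *: M)) i j).
Proof.
under [X in is_derive _ _ X]eq_fun do rewrite expmxE.
have <- : limn (pseries (expmx_coef M (1%:M *m M) i j) t) = (M *m expmx (t *: M)) i j.
  by rewrite mul1mx; apply/cvg_lim => //; exact: cvg_expmx.
exact: is_derive_expmx_coef.
Qed.

Lemma is_derive_expmx_mulmx M (v : 'cV[R]_m) (s t : R) i :
  is_derive t (1 : R) (fun t : R => (expmx ((s + t) *: M) *m v) i 0)
    ((M *m (expmx ((s + t) *: M) *m v)) i 0).
Proof.
have -> : (fun t : R => (expmx ((s + t) *: M) *m v) i 0) =
    \sum_j (v j 0 \*: ((fun t : R => expmx (t *: M) i j) \o shift s)).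
  apply/funext => u; rewrite fct_sumE mxE; apply: eq_bigr => j _.
  by rewrite /= mulrC addrC.
have -> : (M *m (expmx ((s + t) *: M) *m v)) i 0 =
    \sum_j v j 0 *: ((M *m expmx (shift s t *: M)) i j * 1).
  by rewrite mulmxA mxE; apply: eq_bigr => j _; rewrite mulr1 /= [t + s]addrC [RHS]mulrC.
apply: is_derive_sum => j; apply: is_deriveZ.
by apply: is_derive1_comp; [exact: is_derive_expmx|exact: is_derive_shift].
Qed.

Lemma expmx0 : expmx (0 : 'M[R]_m) = 1%:M.
Proof.
apply/cvg_lim; first exact: norm_hausdorff.
apply: cvg_near_cst; exists 1%N => // n /= n0.
rewrite /series/= -(prednK n0) big_nat_recl//=.
rewrite fact0 invr1 scale1r expr0 big1 ?addr0// => k _.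
by rewrite exprS mul0r scaler0.
Qed.

Lemma expmx_flow M (v : 'cV[R]_m) (s T : R) : 0 <= T ->
  flow M T (fun t : R => expmx ((s + t) *: M) *m v).
Proof. by move=> T0; apply: derive_flow => // t i; exact: is_derive_expmx_mulmx. Qed.

(** Applied to a basis vector, both sides are flows of [M] in [t] that agree at 0, so uniqueness
    gives the semigroup law without multiplying series. *)
Lemma expmxD M (s t : R) : 0 <= t ->
  expmx ((s + t) *: M) = expmx (t *: M) *m expmx (s *: M).
Proof.
move=> t0; apply/matrixP => i j.
have colE' (A : 'M[R]_m) : A i j = (A *m delta_mx j 0 : 'cV_m) i 0 by rewrite -colE mxE.
rewrite colE' [RHS]colE' -mulmxA; congr (fun_of_matrix _ i 0).
rewrite -[t in RHS]add0r.
apply: (flow_unique t0 (expmx_flow M _ s t0) (expmx_flow M _ 0 t0)).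
by rewrite !addr0 scale0r expmx0 mul1mx.
Qed.

Lemma expmx_ge0 M (t : R) i j : 0 <= t -> (forall i j, i != j -> 0 <= M i j) ->
  0 <= expmx (t *: M) i j.
Proof.
move=> t0 M0.
have -> : expmx (t *: M) i j = (expmx ((0 + t) *: M) *m delta_mx j 0 : 'cV_m) i 0.
  by rewrite add0r -colE mxE.
apply: (flow_ge0 t0 (expmx_flow M _ 0 t0)) => // k.
by rewrite addr0 scale0r expmx0 mul1mx mxE ler0n.
Qed.

(** Every positive power of [M] also has zero column sums, so only the identity term of the series
    contributes. *)
Lemma expmx_sum1 M (t : R) j : (forall j, \sum_i M i j = 0) ->
  \sum_i expmx (t *: M) i j = 1.
Proof.
move=> M0; have Mk k : \sum_i (M ^+ k.+1) i j = 0.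
  rewrite exprS -mulmxE; under eq_bigr do rewrite mxE.
  by rewrite exchange_big big1// => l _; rewrite -mulr_suml M0 mul0r.
have : \sum_i pseries (expmx_coef M 1%:M i j) t n @[n --> \oo] -->
    \sum_i expmx (t *: M) i j.
  apply: cvg_big; first exact: add_continuous.
  by move=> i _; rewrite -[expmx _]mul1mx; exact: cvg_expmx.
move/cvg_lim => <-//; apply/cvg_lim => //; apply: cvg_near_cst.
exists 1%N => // n /= n0; rewrite /pseries /series/= -(prednK n0) exchange_big/=.
rewrite big_nat_recl//= [X in _ + X]big1 ?addr0 => [|k _]; last first.
  under eq_bigr do rewrite /expmx_coef mul1mx mulrAC.
  by rewrite -mulr_sumr Mk mulr0.
rewrite (bigD1 j)//= big1 ?addr0 => [|i ij];
  rewrite /expmx_coef expr0 fact0 invr1 mul1r mulr1 mulmx1 mxE ?eqxx//.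
by rewrite (negPf ij).
Qed.

Lemma transition_function_expmx M : (forall i j, i != j -> 0 <= M i j) ->
  (forall j, \sum_i M i j = 0) ->
  transition_function (fun t : R => expmx (t *: M)) M.
Proof.
move=> M0 M1; split.
- by move=> t i j t0; exact: expmx_ge0.
- by move=> t j _; exact: expmx_sum1.
- by rewrite scale0r expmx0.
- by move=> s t s0 _; rewrite addrC expmxD.
- apply: cvg_mx => i j; apply: cvg_dnbhs_at_right.
  have [+ +] := is_derive_expmx M 0 i j; rewrite /derivable /derive.
  have -> : M i j = (M *m expmx (0 *: M)) i j by rewrite scale0r expmx0 mulmx1.
  move=> + <-; apply: cvg_trans; apply: near_eq_cvg; near=> h.
  by rewrite /= addr0 [_%:A]mulr1 scale0r expmx0 !mxE.
Unshelve. all: by end_near. Qed.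

End expmx.

(** * Riemann sums of right-continuous functions *)

Section bounded_integration.
Context d (T : measurableType d) (R : realType).
Variables (mu : {measure set T -> \bar R}) (D : set T).
Hypotheses (mD : measurable D) (muD : (mu D < +oo)%E).

Lemma bounded_integrable (f : T -> R) (K : R) : measurable_fun D f ->
  (forall x, D x -> `|f x| <= K) -> mu.-integrable D (EFin \o f).
Proof.
move=> mf fK; apply: measurable_bounded_integrable => //.
exists K; split; first exact: num_real.
by move=> x Kx y Dy; exact: le_trans (fK _ Dy) (ltW Kx).
Qed.

Lemma Rintegral_sum (I : Type) (s : seq I) (f : I -> T -> R) :
  (forall i, mu.-integrable D (EFin \o f i)) ->
  \int[mu]_(x in D) (\sum_(i <- s) f i x) = \sum_(i <- s) \int[mu]_(x in D) f i x.
Proof.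
move=> fi; rewrite /Rintegral; under eq_integral do rewrite -sumEFin.
rewrite integral_sum// -[LHS]/(fine _).
elim: s => [|i s IH]; first by rewrite !big_nil.
rewrite !big_cons fineD ?IH//; first exact: (integrable_fin_num mD (fi i)).
apply: (big_ind (fun x : \bar R => x \is a fin_num)) => // [x y|j _].
  by rewrite fin_numD => -> ->.
exact: (integrable_fin_num mD (fi j)).
Qed.

Lemma cvg_Rintegral_bounded (f_ : nat -> T -> R) (f : T -> R) (K : R) :
  (forall n, measurable_fun D (f_ n)) ->
  (forall n x, D x -> `|f_ n x| <= K) ->
  (forall x, D x -> f_ n x @[n --> \oo] --> f x) ->
  measurable_fun D f /\ \int[mu]_(x in D) f_ n x @[n --> \oo] --> \int[mu]_(x in D) f x.
Proof.
move=> mf_ fK f_f; have mf : measurable_fun D f by exact: measurable_fun_cvg f_f.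
split=> //.
have fK' x : D x -> `|f x| <= K.
  move=> Dx; have cf : `|f_ n x| @[n --> \oo] --> `|f x|.
    by apply: cvg_norm; exact: f_f.
  rewrite -(cvg_lim _ cf)//; apply: limr_le; first by apply/cvg_ex; eexists; exact: cf.
  by apply: nearW => n; exact: fK.
have fi : mu.-integrable D (EFin \o f) by exact: bounded_integrable fK'.
apply: fine_cvg; rewrite /Rintegral fineK; last exact: (integrable_fin_num mD fi).
apply: (@dominated_cvg _ _ _ mu D mD _ _ (EFin \o cst K)).
- by move=> n; apply/measurable_EFinP; exact: mf_.
- by move=> x Dx; apply/cvg_EFin; [exact: nearW|exact: f_f].
- by [].
- by apply: (@bounded_integrable (cst K) `|K|) => //; exact: measurable_cst.
- by move=> n x Dx; rewrite lee_fin fK.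
Qed.

End bounded_integration.

Section riemann.
Context (R : realType).
Notation mu := (@lebesgue_measure R).
Variables (f : R -> R) (K : R).
Hypothesis fK : forall x : R, 0 <= x -> `|f x| <= K.
Hypothesis f_rc : forall x : R, 0 <= x -> f y @[y --> x^'+] --> f x.

(** Right endpoints are sampled: the point standing for [x] is then at or to the right of [x], where
    right continuity controls [f]. *)
Definition riemann_sum (a b : R) (n : nat) : R :=
  \sum_(i < n.+1) (b - a) / n.+1%:R * f (a + (b - a) / n.+1%:R * i.+1%:R).

Let step (a b : R) (n : nat) (x : R) : R :=
  \sum_(i < n.+1) f (a + (b - a) / n.+1%:R * i.+1%:R) *
    \1_(`]a + (b - a) / n.+1%:R * i%:R, a + (b - a) / n.+1%:R * i.+1%:R]%classic) x.

(** The index is the ceiling of [y] minus one, in accordance with intervals open on the left. *)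
Let lt_natr_le n (y : R) : 0 < y -> y <= n%:R ->
  exists2 i : nat, (i < n)%N & i%:R < y <= i.+1%:R.
Proof.
move=> y0; elim: n => [|n IH] yn.
  by move: (lt_le_trans y0 yn); rewrite ltxx.
have [/IH[i ni iy]|ny] := leP y n%:R; first by exists i => //; exact: ltnW.
by exists n => //; rewrite ny.
Qed.

Let stepE (a b : R) n (x : R) : a < x -> x <= b ->
  exists2 y, x <= y <= x + (b - a) / n.+1%:R & step a b n x = f y.
Proof.
move=> ax xb; set h := (b - a) / n.+1%:R.
have h0 : 0 < h by rewrite divr_gt0// subr_gt0 (lt_le_trans ax).
have hn : h * n.+1%:R = b - a by rewrite divfK// pnatr_eq0.
have [i ni /andP[iy yi]] : exists2 i : nat, (i < n.+1)%N & i%:R < (x - a) / h <= i.+1%:R.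
  apply: lt_natr_le; first by rewrite divr_gt0// subr_gt0.
  by rewrite ler_pdivrMr// mulrC hn lerB.
move: iy yi; rewrite ltr_pdivlMr// ler_pdivrMr// => iy yi.
exists (a + h * i.+1%:R).
  by rewrite -natr1 in yi *; apply/andP; split; lra.
rewrite /step (bigD1 (Ordinal ni))//= -/h [X in _ + X]big1 ?addr0.
  rewrite indicE mem_set ?mulr1//= in_itv/=.
  by rewrite -natr1 in yi *; apply/andP; split; lra.
move=> j ji; rewrite indicE memNset ?mulr0//= in_itv/= => /andP[jx xj].
move: ji => /eqP; apply; apply/val_inj => /=; apply/eqP.
have lt_of (k l : nat) : h * k%:R < h * l%:R -> (k < l)%N.
  by rewrite ltr_pM2l// ltr_nat.
by rewrite eqn_leq -ltnS -[(i <= j)%N]ltnS; apply/andP; split; apply: lt_of; lra.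
Qed.

Let measurable_step (a b : R) n (D : set R) : measurable D -> measurable_fun D (step a b n).
Proof.
by move=> mD; apply: measurable_sum => i; apply: measurable_funM.
Qed.

Let Rintegral_step (a b : R) n : a < b ->
  \int[mu]_(x in `]a, b]) step a b n x = riemann_sum a b n.
Proof.
move=> ab; set h := (b - a) / n.+1%:R.
have h0 : 0 < h by rewrite divr_gt0// subr_gt0.
have hn : h * n.+1%:R = b - a by rewrite divfK// pnatr_eq0.
have muab : (mu `]a, b]%classic < +oo)%E.
  by rewrite lebesgue_measure_itv/=; case: ifP => // _; rewrite -EFinB ltry.
have mab : measurable (`]a, b]%classic : set (measurableTypeR R)) by [].
have ii (i : nat) : mu.-integrable `]a, b]
    (EFin \o \1_(`]a + h * i%:R, a + h * i.+1%:R]%classic)).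
  apply: (@bounded_integrable _ (measurableTypeR R) R mu _ mab muab _ 1).
    exact: measurable_indic.
  by move=> x _; rewrite indicE; case: (_ \in _); rewrite ?normr1 ?normr0.
rewrite (@Rintegral_sum _ (measurableTypeR R))//; last first.
  by move=> i; exact: (integrableZl _ (f (a + h * i.+1%:R)) (ii i)).
apply: eq_bigr => i _; rewrite -/h RintegralZl// mulrC; congr (_ * _).
rewrite /Rintegral integral_indic//.
have -> : `]a + h * i%:R, a + h * i.+1%:R]%classic `&` `]a, b]%classic =
    `]a + h * i%:R, a + h * i.+1%:R]%classic.
  apply/setIidPl => x /=; rewrite !in_itv/= => /andP[ix xi].
  apply/andP; split; first by rewrite (le_lt_trans _ ix)// lerDl mulr_ge0// ltW.
  rewrite (le_trans xi)// -lerBrDl -hn ler_pM2l// ler_nat.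
  exact: ltn_ord.
have lenE : mu `]a + h * i%:R, a + h * i.+1%:R]%classic = h%:E.
  rewrite lebesgue_measure_itv/= lte_fin ltrD2l ltr_pM2l// ltr_nat ltnSn/=.
  by rewrite -EFinB -natr1; congr EFin; ring.
exact: (congr1 fine lenE).
Qed.

(** The step functions behind the sums are bounded by [K] and converge pointwise to [f]: the limit
    yields measurability of [f], and dominated convergence yields the integral. *)
Lemma riemann_cvg (a b : R) : 0 <= a -> a <= b ->
  measurable_fun `]a, b]%classic f /\
  riemann_sum a b n @[n --> \oo] --> \int[mu]_(x in `]a, b]) f x.
Proof.
move=> a0; rewrite le_eqVlt => /predU1P[->|ab].
  rewrite set_itv_ge ?bnd_simp ?ltxx//; split; first exact: measurable_fun_set0.
  rewrite Rintegral_set0; apply: cvg_near_cst; apply: nearW => n.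
  by rewrite /riemann_sum big1// => i _; rewrite subrr !mul0r.
have muab : (mu `]a, b]%classic < +oo)%E.
  by rewrite lebesgue_measure_itv/=; case: ifP => // _; rewrite -EFinB ltry.
have mab : measurable (`]a, b]%classic : set (measurableTypeR R)) by [].
have := @cvg_Rintegral_bounded _ (measurableTypeR R) _ mu _ mab muab (step a b) f K.
under eq_cvg do rewrite Rintegral_step//.
apply.
- by move=> n; exact: measurable_step.
- move=> n x /=; rewrite in_itv/= => /andP[ax xb].
  have [y /andP[xy _] ->] := stepE n ax xb.
  by rewrite fK// (le_trans a0)// (le_trans (ltW ax)).
- move=> x /=; rewrite in_itv/= => /andP[ax xb].
  have x0 : 0 <= x by rewrite (le_trans a0)// ltW.
  apply/cvgrPdist_lt => e e0.
  have := f_rc x0 => /cvgrPdist_lt /(_ _ e0) [d /= d0 fd].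
  near=> n; have [y /andP[xy yx] ->] := stepE n ax xb.
  (* The filter at the right of [x] leaves out [x] itself, so a sample point equal to [x] is a
     separate case. *)
  move: xy; rewrite le_eqVlt => /predU1P[<-|xy]; first by rewrite subrr normr0.
  apply: fd => //=; rewrite ltr0_norm ?subr_lt0// opprB ltrBlDl (le_lt_trans yx)//.
  rewrite ltrD2l ltr_pdivrMr// mulrC -ltr_pdivrMr//.
  have /archi_boundP /lt_le_trans : 0 <= (b - a) / d.
    by rewrite ltW// divr_gt0// subr_gt0.
  apply; rewrite ler_nat leqW//; near: n; exact: nbhs_infty_ge.
Unshelve. all: by end_near. Qed.

Lemma right_continuous_integrable (a b : R) : 0 <= a -> a <= b ->
  mu.-integrable `[a, b] (EFin \o f).
Proof.
move=> a0 ab; have [mf _] := riemann_cvg a0 ab.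
have muab : (mu `[a, b]%classic < +oo)%E.
  by rewrite lebesgue_measure_itv/=; case: ifP => // _; rewrite -EFinB ltry.
apply: (@bounded_integrable _ (measurableTypeR R) R mu _ _ muab _ K) => //.
- exact/measurable_fun_itv_obnd_cbndP.
- by move=> x /=; rewrite in_itv/= => /andP[ax _]; rewrite fK// (le_trans a0).
Qed.

Lemma RintegralB_riemann_cvg (a b : R) : 0 <= a -> a <= b ->
  riemann_sum a b n @[n --> \oo] -->
    \int[mu]_(x in `[0, b]) f x - \int[mu]_(x in `[0, a]) f x.
Proof.
move=> a0 ab; rewrite Rintegral_itvB.
- exact: (riemann_cvg a0 ab).2.
- exact: (right_continuous_integrable (lexx 0) (le_trans a0 ab)).
- by rewrite bnd_simp.
- by rewrite bnd_simp.
Qed.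

End riemann.

(** * Expectations of bounded random variables *)

Section expectation.
Context (R : realType) (disp : measure_display) (T : measurableType disp).
Variable P : probability T R.

(** The closure of this class under algebraic operations discharges the integrability conditions met
    below. *)
Definition bounded_rv (f : T -> R) : Prop :=
  measurable_fun setT f /\ exists K, forall w, `|f w| <= K.

Definition Ex (f : T -> R) : R := \int[P]_w f w.

Lemma bounded_rv_cst c : bounded_rv (fun _ => c).
Proof. by split; [exact: measurable_cst|exists `|c|]. Qed.

Lemma bounded_rvD f g : bounded_rv f -> bounded_rv g ->
  bounded_rv (fun w => f w + g w).
Proof.
move=> [mf [Kf fK]] [mg [Kg gK]]; split; first exact: measurable_funD.
by exists (Kf + Kg) => w; rewrite (le_trans (ler_normD _ _))// lerD.
Qed.

Lemma bounded_rvM f g : bounded_rv f -> bounded_rv g ->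
  bounded_rv (fun w => f w * g w).
Proof.
move=> [mf [Kf fK]] [mg [Kg gK]]; split; first exact: measurable_funM.
by exists (Kf * Kg) => w; rewrite normrM ler_pM.
Qed.

Lemma bounded_rvN f : bounded_rv f -> bounded_rv (fun w => - f w).
Proof.
move=> [mf [K fK]]; split; first exact: measurableT_comp.
by exists K => w; rewrite normrN.
Qed.

Lemma bounded_rvB f g : bounded_rv f -> bounded_rv g ->
  bounded_rv (fun w => f w - g w).
Proof. by move=> bf bg; exact/bounded_rvD/bounded_rvN. Qed.

Lemma bounded_rv_norm f : bounded_rv f -> bounded_rv (fun w => `|f w|).
Proof.
move=> [mf [K fK]]; split; first exact: measurableT_comp.
by exists K => w; rewrite normr_id.
Qed.

Lemma bounded_rv_sum (I : Type) (s : seq I) (Q : pred I) (f : I -> T -> R) :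
  (forall i, bounded_rv (f i)) -> bounded_rv (fun w => \sum_(i <- s | Q i) f i w).
Proof.
move=> bf; elim: s => [|i s IH].
  by under eq_fun do rewrite big_nil; exact: bounded_rv_cst.
under eq_fun do rewrite big_cons; case: (Q i) => //; exact: bounded_rvD.
Qed.

Lemma bounded_rv_prod (I : Type) (s : seq I) (Q : pred I) (f : I -> T -> R) :
  (forall i, bounded_rv (f i)) -> bounded_rv (fun w => \prod_(i <- s | Q i) f i w).
Proof.
move=> bf; elim: s => [|i s IH].
  by under eq_fun do rewrite big_nil; exact: bounded_rv_cst.
under eq_fun do rewrite big_cons; case: (Q i) => //; exact: bounded_rvM.
Qed.

Lemma bounded_rv_indic A : measurable A -> bounded_rv (\1_A).
Proof.
move=> mA; split; first exact: measurable_indic.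
by exists 1 => w; rewrite indicE; case: (_ \in _); rewrite ?normr1 ?normr0.
Qed.

Let PT : (P setT < +oo)%E. Proof. by rewrite probability_setT ltry. Qed.

Lemma bounded_rv_integrable f : bounded_rv f -> P.-integrable setT (EFin \o f).
Proof.
by move=> [mf [K fK]]; exact: (bounded_integrable measurableT PT mf (fun w _ => fK w)).
Qed.

Lemma ExD f g : bounded_rv f -> bounded_rv g ->
  Ex (fun w => f w + g w) = Ex f + Ex g.
Proof. by move=> bf bg; apply: RintegralD => //; exact: bounded_rv_integrable. Qed.

Lemma ExB f g : bounded_rv f -> bounded_rv g ->
  Ex (fun w => f w - g w) = Ex f - Ex g.
Proof. by move=> bf bg; apply: RintegralB => //; exact: bounded_rv_integrable. Qed.

Lemma ExZl c f : bounded_rv f -> Ex (fun w => c * f w) = c * Ex f.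
Proof. by move=> bf; apply: RintegralZl => //; exact: bounded_rv_integrable. Qed.

Lemma Ex_sum (I : Type) (s : seq I) (f : I -> T -> R) :
  (forall i, bounded_rv (f i)) ->
  Ex (fun w => \sum_(i <- s) f i w) = \sum_(i <- s) Ex (f i).
Proof. by move=> bf; apply: Rintegral_sum => // i; exact: bounded_rv_integrable. Qed.

Lemma Ex_cst c : Ex (fun _ => c) = c.
Proof.
rewrite /Ex Rintegral_cst// -[RHS]mulr1; congr (_ * _).
exact: (congr1 fine (probability_setT P)).
Qed.

Lemma Ex_le f g : bounded_rv f -> bounded_rv g -> (forall w, f w <= g w) ->
  Ex f <= Ex g.
Proof. by move=> bf bg fg; apply: le_Rintegral => //; exact: bounded_rv_integrable. Qed.

Lemma Ex_norm f : bounded_rv f -> `|Ex f| <= Ex (fun w => `|f w|).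
Proof. by move=> bf; apply: le_normr_Rintegral => //; exact: bounded_rv_integrable. Qed.

Lemma Ex_norm_le f g : bounded_rv f -> bounded_rv g ->
  (forall w, `|f w| <= g w) -> `|Ex f| <= Ex g.
Proof.
move=> bf bg fg; rewrite (le_trans (Ex_norm bf))// Ex_le//.
exact: bounded_rv_norm.
Qed.

Lemma Ex_norm_le_cst f K : bounded_rv f -> (forall w, `|f w| <= K) -> `|Ex f| <= K.
Proof. by move=> bf fK; rewrite -(Ex_cst K) Ex_norm_le//; exact: bounded_rv_cst. Qed.

Lemma Ex_cvg (f_ : nat -> T -> R) (f : T -> R) (K : R) :
  (forall n, measurable_fun setT (f_ n)) -> (forall n w, `|f_ n w| <= K) ->
  (forall w, f_ n w @[n --> \oo] --> f w) -> Ex (f_ n) @[n --> \oo] --> Ex f.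
Proof.
move=> mf fK ff; apply: (proj2 (@cvg_Rintegral_bounded _ _ _ P _ _ PT f_ f K _ _ _)) => //.
Qed.

Lemma Rintegral_Ex A f : \int[P]_(w in A) f w = Ex (fun w => \1_A w * f w).
Proof.
rewrite Rintegral_mkcond; apply: eq_Rintegral => w _.
by rewrite patchE indicE; case: ifPn => wA; rewrite ?mul1r ?mul0r.
Qed.

Lemma integral_Ex A f : measurable A -> bounded_rv f ->
  (\int[P]_(w in A) (f w)%:E = (Ex (fun w => \1_A w * f w)%R)%:E)%E.
Proof.
move=> mA bf; rewrite -Rintegral_Ex /Rintegral fineK//.
apply: (@integrable_fin_num _ _ _ P A mA (EFin \o f)).
exact: integrableS (bounded_rv_integrable bf).
Qed.

(** Phrased on a type that carries the generated sigma-algebra, so that general measurability lemmas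
    apply to it. *)
Definition gen_measurable (C : set (set T)) (f : T -> R) : Prop :=
  @measurable_fun _ _ (g_sigma_algebraType C) R setT f.

Lemma gen_measurable_sub (C C' : set (set T)) f : C `<=` <<s C' >> ->
  gen_measurable C f -> gen_measurable C' f.
Proof.
move=> CC' mf mT B mB; have := mf measurableT B mB.
rewrite /measurable/=; apply: smallest_sub => //; exact: smallest_sigma_algebra.
Qed.

(** A conditional expectation is taken given [<<s C >>], which then itself takes the place of the
    generating family. *)
Lemma gen_measurable_gen (C : set (set T)) f :
  gen_measurable C f -> gen_measurable <<s C >> f.
Proof. by apply: gen_measurable_sub => A CA; do 2! apply: sub_gen_smallest. Qed.

Lemma gen_measurable_measurable (C : set (set T)) f : C `<=` measurable ->
  gen_measurable C f -> measurable_fun setT f.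
Proof.
move=> Cm mf mT B mB; have := mf measurableT B mB.
by apply: smallest_sub => //; exact: sigma_algebra_measurable.
Qed.

Lemma cond_expectation_Ex G X Z A : is_cond_expectation P G X Z ->
  bounded_rv X -> bounded_rv Z -> G A ->
  Ex (fun w => \1_A w * X w) = Ex (fun w => \1_A w * Z w).
Proof.
move=> [[sG Gm] _ _ _ XZ] bX bZ GA; apply: EFin_inj.
by rewrite -!integral_Ex//; [exact: XZ|exact: Gm|exact: Gm].
Qed.

Lemma Ex_cond_expectation C X Z : C `<=` measurable -> bounded_rv X ->
  gen_measurable C Z -> (exists K, forall w, `|Z w| <= K) ->
  (forall A, <<s C >> A -> Ex (fun w => \1_A w * X w) = Ex (fun w => \1_A w * Z w)) ->
  is_cond_expectation P <<s C >> X Z.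
Proof.
move=> Cm bX mZ Zb XZ.
have sCm : <<s C >> `<=` measurable.
  by apply: smallest_sub => //; exact: sigma_algebra_measurable.
have bZ : bounded_rv Z by split=> //; exact: gen_measurable_measurable mZ.
split.
- by split=> //; exact: smallest_sigma_algebra.
- exact: bounded_rv_integrable.
- by move=> _ [B mB <-]; exact: (mZ measurableT B mB).
- exact: bounded_rv_integrable.
- by move=> A GA; rewrite !integral_Ex ?XZ//; exact: sCm.
Qed.

(** The sum counts the integers from 1 to [y], hence is the floor of [y]. *)
Let staircase n (y : R) : 0 <= y -> y <= n%:R ->
  y - 1 <= \sum_(i < n) (i.+1%:R <= y)%R%:R <= y.
Proof.
elim: n => [|n IH] y0 yn; first by rewrite big_ord0 y0 andbT; lra.
rewrite big_ord_recr/=; have [yn'|ny] := leP y n%:R.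
  suff -> : (n.+1%:R <= y) = false by rewrite addr0 IH.
  by apply/negbTE; rewrite -ltNge (le_lt_trans yn')// ltr_nat.
rewrite (eq_bigr (fun=> 1)) => [|i _].
  rewrite sumr_const card_ord; rewrite -natr1 in yn *.
  by have [yn1|yn1] := leP (n%:R + 1) y; apply/andP; split; rewrite /=; lra.
by rewrite (le_trans _ (ltW ny))// ler_nat.
Qed.

(* V is a uniform limit of the averages of the indicators of {V >= i / n}. *)
Lemma cond_expectation_mul G X Z V : is_cond_expectation P G X Z ->
  bounded_rv X -> bounded_rv Z -> gen_measurable G V -> (forall w, 0 <= V w <= 1) ->
  Ex (fun w => V w * X w) = Ex (fun w => V w * Z w).
Proof.
move=> XZ bX bZ mV V01; have [[sG Gm] _ _ _ _] := XZ.
pose A (n i : nat) : set T := [set w | i.+1%:R / n.+1%:R <= V w].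
have GA n i : G (A n i).
  rewrite -(sigma_algebra_id sG).
  have := mV measurableT `[(i.+1%:R / n.+1%:R : R), +oo[%classic (measurable_itv _).
  rewrite setTI; congr (<<s G >> _).
  by apply/seteqP; split=> w /=; rewrite in_itv/= ?andbT.
pose Vn (n : nat) w : R := \sum_(i < n.+1) n.+1%:R^-1 * \1_(A n i) w.
have VnV n w : `|Vn n w - V w| <= n.+1%:R^-1.
  have n0 : 0 < n.+1%:R :> R by rewrite ltr0n.
  have /andP[V0 V1] := V01 w.
  have /andP[] : n.+1%:R * V w - 1 <= \sum_(i < n.+1) (i.+1%:R <= n.+1%:R * V w)%R%:R
     <= n.+1%:R * V w.
    by apply: staircase; [rewrite mulr_ge0|rewrite ler_piMr].
  have -> : \sum_(i < n.+1) (i.+1%:R <= n.+1%:R * V w)%R%:R = n.+1%:R * Vn n w.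
    rewrite /Vn -mulr_sumr mulrA divff ?gt_eqF// mul1r.
    apply: eq_bigr => i _; rewrite indicE; congr (nat_of_bool _)%:R.
    by apply/idP/idP; rewrite inE /A/= ler_pdivrMr// mulrC.
  move=> H1 H2; rewrite ler_norml; 
  have n1 : n.+1%:R * n.+1%:R^-1 = 1 :> R by rewrite divff ?gt_eqF.
  apply/andP; split; rewrite -(ler_pM2l n0) mulrBr ?mulrN n1.
    by rewrite lerBrDr addrC.
  by rewrite lerBlDl (le_trans H2)// lerDl.
have bV : bounded_rv V.
  split; first by apply: gen_measurable_measurable mV.
  by exists 1 => w; have /andP[V0 V1] := V01 w; rewrite ger0_norm.
have bVn n : bounded_rv (Vn n).
  apply: bounded_rv_sum => i; apply: bounded_rvM; first exact: bounded_rv_cst.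
  by apply: bounded_rv_indic; exact: Gm.
have cvgVn Y : bounded_rv Y ->
    Ex (fun w => Vn n w * Y w) @[n --> \oo] --> Ex (fun w => V w * Y w).
  move=> bY; have [mY [K YK]] := bY.
  apply: (@Ex_cvg _ _ (2 * K)).
  - by move=> n; apply: (bounded_rvM (bVn n) bY).1.
  - move=> n w; rewrite normrM ler_pM//.
    have /andP[V0 V1] := V01 w; rewrite -[Vn n w](subrK (V w)).
    rewrite (le_trans (ler_normD _ _))// [2]mulr2n lerD ?(ger0_norm V0)//.
    by rewrite (le_trans (VnV n w))// invf_le1// ler1n.
  - move=> w; apply: cvgMl.
    apply/cvgrPdist_le => e e0; near=> n; rewrite distrC (le_trans (VnV n w))//.
    by near: n; apply: filterS (near_infty_natSinv_lt (PosNum e0)) => n /ltW.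
have VnE n : Ex (fun w => Vn n w * X w) = Ex (fun w => Vn n w * Z w).
  have VnY Y : bounded_rv Y -> Ex (fun w => Vn n w * Y w) =
      \sum_(i < n.+1) n.+1%:R^-1 * Ex (fun w => \1_(A n i) w * Y w).
    move=> bY; have bi i : bounded_rv (fun w => \1_(A n i) w * Y w).
      by apply: bounded_rvM => //; apply: bounded_rv_indic; exact: Gm.
    rewrite -[RHS]/(\sum_(i < n.+1) _).
    under [RHS]eq_bigr do rewrite -ExZl//.
    rewrite -Ex_sum; last first.
      by move=> i; apply: bounded_rvM => //; exact: bounded_rv_cst.
    congr Ex; apply/funext => w; rewrite /Vn mulr_suml.
    by apply: eq_bigr => i _; rewrite mulrA.
  rewrite !VnY//; apply: eq_bigr => i _; congr (_ * _).
  exact: cond_expectation_Ex XZ _ _ _.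
have := cvgVn _ bX; rewrite (funext VnE) => cX.
rewrite -(cvg_lim (@norm_hausdorff _ R) cX).
exact: (cvg_lim (@norm_hausdorff _ R) (cvgVn _ bZ)).
Unshelve. all: by end_near. Qed.

End expectation.

Lemma sum_mxtens_unindex (R : nmodType) k d (F : 'I_k -> 'I_d -> R) :
  \sum_(x < k * d) F (mxtens_unindex x).1 (mxtens_unindex x).2 =
  \sum_l \sum_j F l j.
Proof.
rewrite pair_big; apply/esym.
rewrite (reindex (@mxtens_unindex k d)) //=.
by exists (@mxtens_index k d) => x _; rewrite (mxtens_indexK, mxtens_unindexK).
Qed.

(** * The Markov chain and its cumulative hazard *)

Section markov_chain.
Context (R : realType) (disp : measure_display) (T : measurableType disp).
Variables (P : probability T R) (d : nat) (X : R -> T -> 'cV[R]_d).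
Variables (Q : 'M[R]_d) (lam : 'cV[R]_d).
Hypothesis hX : is_markov_chain P (natural_filtration X) X Q.
Hypothesis hlam : forall i : 'I_d, 0 <= lam i 0.
Implicit Types (s t a b K : R) (w : T).

(** Measurability of the process is extracted from the Markov property at equal times, whose
    conditional expectation includes that its sigma-algebra consists of measurable sets. *)
Lemma process_events_sub_measurable t : 0 <= t ->
  process_events `[0, t] X `<=` measurable.
Proof.
move=> t0 A [u + [i _ XA]]; rewrite /= in_itv/= => /andP[u0 ut].
have [_ _ _ [p _ /(_ t t i t0 (lexx t))]] := hX.
move=> [[_ Fm] _ _ _ _]; apply: Fm; apply: sub_gen_smallest.
by exists u; [rewrite /= in_itv/= u0|exists i].
Qed.

Lemma gen_measurable_process s t i : 0 <= s -> s <= t ->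
  gen_measurable (process_events `[0, t] X) (fun w => X s w i 0).
Proof.
move=> s0 st mT B mB; apply: sub_gen_smallest.
exists s; first by rewrite /= in_itv/= s0.
by exists i => //; exists B.
Qed.

Lemma bounded_rv_gen t (f : T -> R) (K : R) : 0 <= t ->
  gen_measurable (process_events `[0, t] X) f -> (forall w, `|f w| <= K) ->
  bounded_rv f.
Proof.
move=> t0 mf fK; split; last by exists K.
exact: gen_measurable_measurable (process_events_sub_measurable t0) mf.
Qed.

Lemma chain_basis t w : 0 <= t -> exists i : 'I_d, X t w = delta_mx i 0.
Proof. by have [+ _ _ _] := hX; exact. Qed.

Lemma chain_ge0 t w i : 0 <= t -> 0 <= X t w i 0.
Proof. by move=> /(chain_basis w)[j ->]; rewrite mxE ler0n. Qed.

Lemma chain_le1 t w i : 0 <= t -> X t w i 0 <= 1.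
Proof. by move=> /(chain_basis w)[j ->]; rewrite mxE lern1 leq_b1. Qed.

Lemma chain_norm t w i : 0 <= t -> `|X t w i 0| <= 1.
Proof. by move=> t0; rewrite ger0_norm ?chain_le1// chain_ge0. Qed.

Lemma bounded_rv_chain t i : 0 <= t -> bounded_rv (fun w => X t w i 0).
Proof.
move=> t0; apply: (@bounded_rv_gen t _ 1) => //.
  exact: gen_measurable_process.
by move=> w; exact: chain_norm.
Qed.

Definition hazard (t : R) (w : T) : R := (lam^T *m X t w) 0 0.

Definition hazard_bound : R := \sum_i lam i 0.

Lemma hazardE t w : hazard t w = \sum_i lam i 0 * X t w i 0.
Proof. by rewrite /hazard mxE; apply: eq_bigr => i _; rewrite mxE. Qed.

Lemma hazard_ge0 t w : 0 <= t -> 0 <= hazard t w.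
Proof.
move=> t0; rewrite hazardE; apply: sumr_ge0 => i _.
by rewrite mulr_ge0// chain_ge0.
Qed.

Lemma hazard_le t w : 0 <= t -> hazard t w <= hazard_bound.
Proof.
move=> t0; rewrite hazardE; apply: ler_sum => i _.
by rewrite ler_piMr// chain_le1.
Qed.

Lemma hazard_norm t w : 0 <= t -> `|hazard t w| <= hazard_bound.
Proof. by move=> t0; rewrite ger0_norm ?hazard_ge0// hazard_le. Qed.

Lemma hazard_bound_ge0 : 0 <= hazard_bound.
Proof. exact: sumr_ge0. Qed.

(** [X t w i 0] is nonzero only when the chain sits at [i], where the hazard is [lam i 0]. *)
Lemma hazard_chain t w i : 0 <= t -> hazard t w * X t w i 0 = lam i 0 * X t w i 0.
Proof.
move=> t0; rewrite hazardE; have [j ->] := chain_basis w t0.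
rewrite (bigD1 j)//= !mxE !eqxx big1 => [|k /negPf kj]; last first.
  by rewrite mxE kj mulr0.
rewrite addr0 mulr1 andbT; have [->//|_] := eqVneq i j.
by rewrite !mulr0.
Qed.

Lemma hazard_rc t w : 0 <= t -> hazard u w @[u --> t^'+] --> hazard t w.
Proof.
move=> t0; under eq_cvg do rewrite hazardE.
rewrite hazardE; apply: cvg_big; first exact: add_continuous.
move=> i _; apply: cvgMr; have [_ /(_ t w t0) Xrc _ _] := hX.
apply: (@cvg_comp _ _ _ (X^~ w) (fun M : 'cV[R]_d => M i 0) _ _ _ Xrc).
exact: coord_continuous.
Qed.

Lemma gen_measurable_hazard s t : 0 <= s -> s <= t ->
  gen_measurable (process_events `[0, t] X) (hazard s).
Proof.
move=> s0 st; rewrite (_ : hazard s = fun w => \sum_i lam i 0 * X s w i 0); last first.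
  by apply/funext => w; rewrite hazardE.
apply: measurable_sum => i; apply: measurable_funM => //.
exact: gen_measurable_process.
Qed.

Definition cumulative_hazard (t : R) (w : T) : R :=
  \int[lebesgue_measure]_(s in `[0, t]) hazard s w.

(** Bounds, measurability and the mean expansion of the cumulative hazard are read off from these
    sums, which avoids integrating jointly in time and [w]. *)
Lemma cumulative_hazard_riemann a b w : 0 <= a -> a <= b ->
  riemann_sum (hazard^~ w) a b n @[n --> \oo] -->
    cumulative_hazard b w - cumulative_hazard a w.
Proof.
move=> a0 ab; apply: (@RintegralB_riemann_cvg _ (hazard^~ w) hazard_bound) => //.
  by move=> x; exact: hazard_norm.
by move=> x; exact: hazard_rc.
Qed.

Lemma cumulative_hazard0 w : cumulative_hazard 0 w = 0.
Proof. by rewrite /cumulative_hazard set_itv1 Rintegral_set1. Qed.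

Lemma riemann_point (a b : R) n i : a <= b -> (i < n.+1)%N ->
  a <= a + (b - a) / n.+1%:R * i.+1%:R <= b.
Proof.
move=> ab ni; rewrite lerDl mulr_ge0 ?divr_ge0 ?subr_ge0//=.
rewrite -lerBrDl mulrAC ler_pdivrMr ?ltr0n// ler_wpM2l ?subr_ge0//.
by rewrite ler_nat.
Qed.

Lemma riemann_sum_norm_le (f : R -> R) a b n K : a <= b ->
  (forall x, a <= x -> x <= b -> `|f x| <= K) ->
  `|riemann_sum f a b n| <= K * (b - a).
Proof.
move=> ab fK; rewrite (le_trans (ler_norm_sum _ _ _))//.
apply: (@le_trans _ _ (\sum_(i < n.+1) (b - a) / n.+1%:R * K)).
  apply: ler_sum => i _; have /andP[? ?] := riemann_point ab (ltn_ord i).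
  by rewrite normrM ger0_norm ?divr_ge0 ?subr_ge0// ler_wpM2l ?fK// divr_ge0// subr_ge0.
rewrite sumr_const card_ord -[leLHS]mulr_natr mulrAC divfK ?pnatr_eq0//.
by rewrite mulrC.
Qed.

Lemma cumulative_hazard_incr a b w : 0 <= a -> a <= b ->
  0 <= cumulative_hazard b w - cumulative_hazard a w <= hazard_bound * (b - a).
Proof.
move=> a0 ab; have cr := @cumulative_hazard_riemann a b w a0 ab.
have ccr : cvg (riemann_sum (hazard^~ w) a b n @[n --> \oo]).
  by apply/cvg_ex; eexists; exact: cr.
rewrite -(cvg_lim (@norm_hausdorff _ R) cr); apply/andP; split.
  apply: limr_ge => //; apply: nearW => n; apply: sumr_ge0 => i _.
  have /andP[ai _] := riemann_point ab (ltn_ord i).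
  by rewrite mulr_ge0 ?divr_ge0 ?subr_ge0// hazard_ge0// (le_trans a0).
apply: limr_le => //; apply: nearW => n.
rewrite (le_trans (ler_norm _))// riemann_sum_norm_le// => x ax _.
by rewrite hazard_norm// (le_trans a0).
Qed.

Lemma cumulative_hazard_ge0 t w : 0 <= t -> 0 <= cumulative_hazard t w.
Proof.
by move=> /(cumulative_hazard_incr w (lexx 0)); rewrite cumulative_hazard0 !subr0 => /andP[].
Qed.

Lemma cumulative_hazard_le t w : 0 <= t -> cumulative_hazard t w <= hazard_bound * t.
Proof.
by move=> /(cumulative_hazard_incr w (lexx 0)); rewrite cumulative_hazard0 !subr0 => /andP[].
Qed.

(** A pointwise limit of Riemann sums whose sample times all lie in [[0, s]]. *)
Lemma gen_measurable_cumulative_hazard s t : 0 <= s -> s <= t ->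
  gen_measurable (process_events `[0, t] X) (cumulative_hazard s).
Proof.
move=> s0 st.
apply: (@measurable_fun_cvg _ (g_sigma_algebraType (process_events `[0, t] X)) R setT
  (fun n w => riemann_sum (hazard^~ w) 0 s n)).
  move=> n; apply: measurable_sum => i; apply: measurable_funM => //.
  have /andP[? si] := riemann_point s0 (ltn_ord i).
  by apply: gen_measurable_hazard => //; exact: le_trans st.
move=> w _; have := @cumulative_hazard_riemann 0 s w (lexx 0) s0.
by rewrite cumulative_hazard0 subr0.
Qed.

End markov_chain.

(** * First-order behaviour in mean of the chain and of its cumulative hazard *)

Section feynman_kac.
Context (R : realType) (disp : measure_display) (T : measurableType disp).
Variables (P : probability T R) (d : nat) (X : R -> T -> 'cV[R]_d).
Variables (Q : 'M[R]_d) (lam : 'cV[R]_d).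
Hypothesis hX : is_markov_chain P (natural_filtration X) X Q.
Hypothesis hlam : forall i : 'I_d, 0 <= lam i 0.
Implicit Types (s t a b K : R) (w : T).

Notation Kl := (hazard_bound lam).
Notation Lam := (cumulative_hazard X lam).

Lemma at_right0_ex (G : R -> Prop) : (\forall h \near 0^'+, G h) ->
  exists2 h0, 0 < h0 & forall h, 0 < h -> h < h0 -> G h.
Proof.
move=> [h0 /= h00 hG]; exists h0 => // h h_gt0 hh0; apply: hG => //=.
by rewrite sub0r normrN gtr0_norm.
Qed.

Lemma transition_function_taylor p (q : 'M[R]_d) : transition_function p q ->
  forall e, 0 < e -> \forall h \near 0^'+,
    forall ij : 'I_d * 'I_d,
      `|p h ij.1 ij.2 - (ij.1 == ij.2)%:R - h * q ij.1 ij.2| <= e * h.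
Proof.
move=> [_ _ _ _ pq] e e0; apply: filter_forall => -[i j] /=.
have : (h^-1 *: (p h - 1%:M)) i j @[h --> 0^'+] --> q i j.
  apply: (@cvg_comp _ _ _ (fun h => h^-1 *: (p h - 1%:M))
    (fun M : 'M[R]_d => M i j) _ _ _ pq).
  exact: coord_continuous.
move=> /cvgrPdist_le /(_ _ e0) pij; near=> h.
have h0 : 0 < h by near: h; exact: nbhs_right_gt.
have : `|q i j - (h^-1 *: (p h - 1%:M)) i j| <= e by near: h.
rewrite !mxE distrC -(ler_pM2r h0) => /(le_trans _); apply.
rewrite -[X in _ <= _ * X](gtr0_norm h0) -normrM.
by rewrite le_eqVlt; apply/orP; left; apply/eqP; congr `|_|; field; rewrite gt_eqF.
Unshelve. all: by end_near. Qed.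

Lemma transition_function_cvg1 p (q : 'M[R]_d) : transition_function p q ->
  forall e, 0 < e -> \forall h \near 0^'+, forall ij : 'I_d * 'I_d,
    `|p h ij.1 ij.2 - (ij.1 == ij.2)%:R| <= e.
Proof.
move=> tp e e0; pose K := \sum_i \sum_j `|q i j|.
have K0 : 0 <= K by apply: sumr_ge0 => i _; exact: sumr_ge0.
have K1 : 0 < 1 + K by rewrite ltr_pwDl.
have ptaylor := transition_function_taylor tp (@ltr01 R).
near=> h.
have ph : forall ij : 'I_d * 'I_d,
    `|p h ij.1 ij.2 - (ij.1 == ij.2)%:R - h * q ij.1 ij.2| <= 1 * h by near: h.
have h0 : 0 < h by near: h; exact: nbhs_right_gt.
move=> [i j] /=; have hij := ph (i, j).
rewrite -[X in `|X|](subrK (h * q i j)) (le_trans (ler_normD _ _))//.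
apply: (@le_trans _ _ (h * (1 + K))).
  rewrite mulrDr [h * 1]mulrC lerD// normrM gtr0_norm// ler_wpM2l ?(ltW h0)//.
  rewrite /K (bigD1 i)//= (bigD1 j)//= -addrA lerDl addr_ge0// sumr_ge0// => k _.
  exact: sumr_ge0.
rewrite -ler_pdivlMr//; near: h; apply: nbhs_right_le.
by rewrite divr_gt0.
Unshelve. all: by end_near. Qed.

(** Uniform in [u]: after conditioning at time [u] only the probabilities [p h j j] remain, and they
    tend to 1. *)
Lemma chain_continuous_Ex e : 0 < e -> exists2 h0, 0 < h0 &
  forall u h, 0 <= u -> 0 <= h -> h < h0 ->
    forall i, Ex P (fun w => `|X (u + h) w i 0 - X u w i 0|) <= e.
Proof.
move=> e0; have [_ _ _ [p tp pX]] := hX.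
(* Half of [e] absorbs the factor 2 in the bound by the scalar product. *)
have e20 : 0 < e / 2 by rewrite divr_gt0.
have [D D0 HD] := at_right0_ex (transition_function_cvg1 tp e20).
exists D => // u h u0; rewrite le_eqVlt => /predU1P[<- _ i|h0 hD i].
  rewrite addr0 (_ : (fun _ => _) = fun _ => 0) ?Ex_cst ?ltW//.
  by apply/funext => w; rewrite subrr normr0.
have uh0 : 0 <= u + h by rewrite addr_ge0// ltW.
have bX j := bounded_rv_chain hX j u0; have bX' j := bounded_rv_chain hX j uh0.
have bXX j : bounded_rv (fun w => X u w j 0 * X (u + h) w j 0) by exact: bounded_rvM.
have XX j : Ex P (fun w => X u w j 0 * X (u + h) w j 0) = p h j j * Ex P (fun w => X u w j 0).
  have := pX u (u + h) j u0; rewrite lerDl => /(_ (ltW h0)) cXp.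
  rewrite addrAC subrr add0r in cXp.
  have bpX : bounded_rv (fun w => (p h *m X u w) j 0).
    under eq_fun do rewrite mxE.
    by apply: bounded_rv_sum => k; apply: bounded_rvM => //; exact: bounded_rv_cst.
  rewrite (cond_expectation_mul cXp)//.
  - rewrite -ExZl//; congr Ex; apply/funext => w.
    have [k ->] := chain_basis hX w u0.
    rewrite -colE !mxE; have [->|kj] := eqVneq j k; first by rewrite mulrC.
    by rewrite /= mul0r mulr0.
  - by apply: gen_measurable_gen; exact: gen_measurable_process.
  - by move=> w; rewrite (chain_ge0 hX)// (chain_le1 hX).
(* On basis vectors |x_i - y_i| <= 2 - 2 <x, y>, and the mean of the scalar
   product only involves the transition function. *)
apply: (@le_trans _ _ (Ex P (fun w => 2 - 2 * \sum_j (X u w j 0 * X (u + h) w j 0)))).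
  apply: Ex_le.
  - by apply: bounded_rv_norm; exact: bounded_rvB.
  - apply: bounded_rvB; first exact: bounded_rv_cst.
    by apply: bounded_rvM; [exact: bounded_rv_cst|exact: bounded_rv_sum].
  - move=> w; have [k ->] := chain_basis hX w u0; have [l ->] := chain_basis hX w uh0.
    have -> : \sum_j (delta_mx k 0 : 'cV[R]_d) j 0 * (delta_mx l 0 : 'cV[R]_d) j 0 = (k == l)%:R.
      rewrite (bigD1 k)//= big1 => [|j /negPf jk]; last by rewrite mxE jk mul0r.
      by rewrite !mxE !eqxx mul1r addr0 andbT.
    have [<-|kl] := eqVneq k l; first by rewrite subrr normr0 mulr1 subrr.
    rewrite mulr0 subr0 (le_trans (ler_normB _ _))// !mxE !normr_nat.
    by rewrite [leRHS]mulr2n lerD// lern1 leq_b1.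
rewrite ExB; last 2 first.
- exact: bounded_rv_cst.
- by apply: bounded_rvM; [exact: bounded_rv_cst|exact: bounded_rv_sum].
rewrite Ex_cst ExZl; last exact: bounded_rv_sum.
rewrite Ex_sum//; under eq_bigr do rewrite XX.
have EX1 : \sum_j Ex P (fun w => X u w j 0) = 1.
  rewrite -Ex_sum// -[RHS](Ex_cst P); congr Ex; apply/funext => w.
  have [k ->] := chain_basis hX w u0.
  rewrite (bigD1 k)//= mxE !eqxx big1 ?addr0// => j /negPf jk.
  by rewrite mxE jk.
have -> : 2 - 2 * \sum_j p h j j * Ex P (fun w => X u w j 0) =
    2 * \sum_j (1 - p h j j) * Ex P (fun w => X u w j 0).
  under [X in _ = 2 * X]eq_bigr do rewrite mulrBl mul1r.
  by rewrite sumrB EX1 mulrBr mulr1.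
rewrite -ler_pdivlMl// mulrC -[leRHS]mulr1 -[X in _ <= _ * X]EX1 mulr_sumr.
apply: ler_sum => j _.
rewrite ler_wpM2r//.
  rewrite -(Ex_cst P 0) Ex_le//; first exact: bounded_rv_cst.
  by move=> w; exact: (chain_ge0 hX).
have := HD h h0 hD (j, j); rewrite /= eqxx distrC => /(le_trans _); apply.
exact: ler_norm.
Qed.

(** In a Riemann sum the expectation passes inside a finite sum, where each increment of the chain
    is small in mean; bounded convergence carries the bound over to the integral. *)
Lemma cumulative_hazard_derivative e : 0 < e -> exists2 h0, 0 < h0 &
  forall u h, 0 <= u -> 0 <= h -> h < h0 ->
    Ex P (fun w => `|Lam (u + h) w - Lam u w - h * hazard X lam u w|) <= e * h.
Proof.
move=> e0; have K0 : 0 <= Kl by exact: hazard_bound_ge0.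
(* The rates sum to [Kl]; the added 1 keeps the denominator positive when they all vanish. *)
have e1 : 0 < e / (Kl + 1) by rewrite divr_gt0// ltr_wpDl.
have [D D0 HD] := chain_continuous_Ex e1.
exists D => // u h u0 h0 hD.
have uh : u <= u + h by rewrite lerDl.
have uh0 : 0 <= u + h by rewrite addr_ge0.
pose nu n w := riemann_sum (fun x => hazard X lam x w - hazard X lam u w) u (u + h) n.
have nuE n w : nu n w = riemann_sum (hazard X lam ^~ w) u (u + h) n - h * hazard X lam u w.
  rewrite /nu /riemann_sum addrAC subrr add0r.
  under eq_bigr do rewrite mulrBr.
  rewrite sumrB; congr (_ - _); rewrite sumr_const card_ord -[LHS]mulr_natr mulrAC.
  by rewrite divfK// pnatr_eq0.
have bhaz x : 0 <= x -> bounded_rv (hazard X lam x).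
  move=> x0; apply: (@bounded_rv_gen _ _ _ _ _ _ _ hX x _ Kl) => //.
    exact: gen_measurable_hazard.
  by move=> w; exact: (hazard_norm hX).
have pt n (i : 'I_n.+1) := riemann_point uh (ltn_ord i).
have bnu n : bounded_rv (nu n).
  apply: bounded_rv_sum => i; apply: bounded_rvM; first exact: bounded_rv_cst.
  apply: bounded_rvB; apply: bhaz => //.
  by have /andP[ui _] := pt n i; rewrite (le_trans u0).
have cnu w : `|nu n w| @[n --> \oo] --> `|Lam (u + h) w - Lam u w - h * hazard X lam u w|.
  apply: cvg_norm; under eq_cvg do rewrite nuE.
  apply: cvgB; last exact: cvg_cst.
  exact: (cumulative_hazard_riemann hX).
have nuK n w : `| `|nu n w| | <= (Kl + Kl) * h.
  rewrite normr_id -[X in _ * X](addrK u) [h + u]addrC.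
  apply: riemann_sum_norm_le => // x ux _; rewrite (le_trans (ler_normB _ _))//.
  by rewrite lerD// (hazard_norm hX)// (le_trans u0).
have cE := Ex_cvg (fun n => (bounded_rv_norm (bnu n)).1) nuK cnu.
rewrite -(cvg_lim (@norm_hausdorff _ R) (cE P)); apply: limr_le.
  by apply/cvg_ex; eexists; exact: cE.
apply: nearW => n.
have bdX x : 0 <= x -> bounded_rv (fun w => \sum_j lam j 0 * `|X x w j 0 - X u w j 0|).
  move=> x0; apply: bounded_rv_sum => j; apply: bounded_rvM; first exact: bounded_rv_cst.
  by apply: bounded_rv_norm; apply: bounded_rvB; exact: (bounded_rv_chain hX).
pose x (i : 'I_n.+1) := u + (u + h - u) / n.+1%:R * i.+1%:R.
have x0 i : 0 <= x i by have /andP[+ _] := pt n i; exact: le_trans.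
apply: (@le_trans _ _ (Ex P (fun w => \sum_(i < n.+1) (u + h - u) / n.+1%:R *
    \sum_j lam j 0 * `|X (x i) w j 0 - X u w j 0|))).
  apply: Ex_le.
  - exact: bounded_rv_norm.
  - apply: bounded_rv_sum => i; apply: bounded_rvM; first exact: bounded_rv_cst.
    exact: bdX.
  - move=> w; rewrite (le_trans (ler_norm_sum _ _ _))//; apply: ler_sum => i _.
    have c0 : 0 <= (u + h - u) / n.+1%:R by rewrite divr_ge0// subr_ge0.
    rewrite normrM ger0_norm// ler_wpM2l// !hazardE -sumrB.
    rewrite (le_trans (ler_norm_sum _ _ _))//; apply: ler_sum => j _.
    by rewrite -mulrBr normrM ger0_norm.
rewrite Ex_sum; last first.
  by move=> i; apply: bounded_rvM; [exact: bounded_rv_cst|exact: bdX].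
apply: (@le_trans _ _ (\sum_(i < n.+1) h / n.+1%:R * e)); last first.
  rewrite sumr_const card_ord -[leLHS]mulr_natr mulrAC divfK ?pnatr_eq0//.
  by rewrite mulrC.
apply: ler_sum => i _; rewrite ExZl; last exact: bdX.
rewrite addrAC subrr add0r ler_wpM2l ?divr_ge0//.
rewrite Ex_sum; last first.
  move=> j; apply: bounded_rvM; first exact: bounded_rv_cst.
  by apply: bounded_rv_norm; apply: bounded_rvB; exact: (bounded_rv_chain hX).
apply: (@le_trans _ _ (\sum_j lam j 0 * (e / (Kl + 1)))).
  apply: ler_sum => j _; rewrite ExZl; last first.
    by apply: bounded_rv_norm; apply: bounded_rvB; exact: (bounded_rv_chain hX).
  rewrite ler_wpM2l//; have /andP[ux xuh] := pt n i.
  rewrite /x; apply: HD => //; first by move: ux; rewrite lerDl.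
  by move: xuh; rewrite lerD2l => /le_lt_trans; apply.
rewrite -mulr_suml -/(hazard_bound lam) mulrA ler_pdivrMr ?ltr_wpDl//.
by rewrite mulrC ler_pM2l// lerDl.
Qed.

End feynman_kac.

(** * Evolution of the weighted means after time [s] *)

Section one_step.
Context (R : realType) (disp : measure_display) (T : measurableType disp).
Variables (P : probability T R) (d : nat) (X : R -> T -> 'cV[R]_d).
Variables (Q : 'M[R]_d) (lam : 'cV[R]_d).
Hypothesis hX : is_markov_chain P (natural_filtration X) X Q.
Hypothesis hlam : forall i : 'I_d, 0 <= lam i 0.
Variables (k : nat) (A : 'M[R]_k) (psi : R -> 'cV[R]_k).
Hypothesis psi_derive : forall (a : R) l,
  is_derive a (1 : R) (fun a : R => psi a l 0) ((A *m psi a) l 0).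
Hypothesis psi01 : forall (a : R) l, 0 <= a -> 0 <= psi a l 0 <= 1.
Variables (s : R) (W : T -> R).
Hypothesis s0 : 0 <= s.
Hypothesis mW : gen_measurable (process_events `[0, s] X) W.
Hypothesis W01 : forall w, 0 <= W w <= 1.
Implicit Types (t a b K u h : R) (w : T).

Notation Kl := (hazard_bound lam).
Notation Lam := (cumulative_hazard X lam).

Definition weighted_mean u l i : R :=
  Ex P (fun w => W w * psi (Lam u w) l 0 * X u w i 0).

Let gen_sub t t' : t <= t' -> process_events `[0, t] X `<=` <<s process_events `[0, t'] X >>.
Proof.
move=> tt' B [u + HB]; rewrite /= in_itv/= => /andP[u0 ut]; apply: sub_gen_smallest.
by exists u => //; rewrite /= in_itv/= u0 (le_trans ut).
Qed.

Let mV u l : s <= u -> gen_measurable (process_events `[0, u] X)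
  (fun w => W w * psi (Lam u w) l 0).
Proof.
move=> su; apply: measurable_funM.
  exact: gen_measurable_sub (gen_sub su) mW.
apply: (@measurableT_comp _ _ _ _ _ _ (fun a => psi a l 0)).
  apply: continuous_measurable_fun => a; have da := psi_derive a l.
  exact/differentiable_continuous/derivable1_diffP.
by apply: (gen_measurable_cumulative_hazard hX) => //; exact: le_trans su.
Qed.

Let V01 u l w : 0 <= u -> 0 <= W w * psi (Lam u w) l 0 <= 1.
Proof.
move=> u0; have /andP[w0 w1] := W01 w.
have /andP[p0 p1] := psi01 l (cumulative_hazard_ge0 hX hlam w u0).
by rewrite mulr_ge0// mulr_ile1.
Qed.

Let bV u l : s <= u -> bounded_rv (fun w => W w * psi (Lam u w) l 0).
Proof.
move=> su; have u0 := le_trans s0 su.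
apply: (@bounded_rv_gen _ _ _ _ _ _ _ hX u _ 1) => //; first exact: mV.
by move=> w; have /andP[? ?] := V01 l w u0; rewrite ger0_norm.
Qed.

Let bVX u l i : s <= u -> bounded_rv (fun w => W w * psi (Lam u w) l 0 * X u w i 0).
Proof.
move=> su; apply: bounded_rvM; first exact: bV.
by apply: (bounded_rv_chain hX); exact: le_trans su.
Qed.

Let bD u l : s <= u -> bounded_rv (fun w => W w * (A *m psi (Lam u w)) l 0).
Proof.
move=> su; rewrite (_ : (fun _ => _) = fun w =>
    \sum_m A l m * (W w * psi (Lam u w) m 0)); last first.
  apply/funext => w; rewrite mxE mulr_sumr; apply: eq_bigr => m _.
  by rewrite mulrCA.
apply: bounded_rv_sum => m; apply: bounded_rvM; first exact: bounded_rv_cst.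
exact: bV.
Qed.

Let D_le u l w : 0 <= u -> `|W w * (A *m psi (Lam u w)) l 0| <= l1opnorm A.
Proof.
move=> u0; have /andP[w0 w1] := W01 w.
rewrite normrM ger0_norm// -[leRHS]mul1r ler_pM// mxE.
rewrite (le_trans (ler_norm_sum _ _ _))// /l1opnorm [leRHS](bigD1 l)//=.
rewrite -[leLHS]addr0 lerD//; last by apply: sumr_ge0 => i _; exact: sumr_ge0.
apply: ler_sum => j _; rewrite normrM ler_piMr//.
have /andP[p0 p1] := psi01 j (cumulative_hazard_ge0 hX hlam w u0).
by rewrite ger0_norm.
Qed.

Let weighted_mean_le u l i : s <= u -> `|weighted_mean u l i| <= 1.
Proof.
move=> su; have u0 := le_trans s0 su.
apply: Ex_norm_le_cst; first exact: bVX.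
move=> w; have /andP[v0 v1] := V01 l w u0.
by rewrite normrM mulr_ile1 ?(chain_norm hX)// ger0_norm.
Qed.

(** Four errors arise: the Taylor remainder of [psi], the increment of [Lam] replaced by [h] times
    the hazard, the later state of the chain replaced by the earlier one, and the expansion of the
    transition function. The first is quadratic in [h] on every path, the next two are small in
    mean, the last is deterministic. *)
Lemma weighted_mean_taylor t e : 0 <= t -> 0 < e -> exists2 h0, 0 < h0 &
  forall u h, s <= u -> 0 < h -> h < h0 -> u + h <= t -> forall l i,
  `|weighted_mean (u + h) l i - weighted_mean u l i -
    h * (lam i 0 * (\sum_m A l m * weighted_mean u m i) +
         \sum_j Q i j * weighted_mean u l j)| <= e * h.
Proof.
move=> t0 e0; have Kl0 : 0 <= Kl by exact: hazard_bound_ge0.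
have e40 : 0 < e / 4 by rewrite divr_gt0.
(* Up to time [t], [Lam] stays in [[0, Kl * t]], so one constant serves all paths. *)
have [K K0 HK] := mean_value_taylor psi_derive (mulr_ge0 Kl0 t0).
set B := l1opnorm A; have B0 : 0 <= B by exact: l1opnorm_ge0.
have B1 : 0 < B + 1 by rewrite ltr_wpDl.
have K1 : 0 < Kl + 1 by rewrite ltr_wpDl.
have d1 : 0 < d%:R + 1 :> R by rewrite ltr_wpDl.
have KK1 : 0 < K * Kl ^+ 2 + 1 by rewrite ltr_wpDl// mulr_ge0// exprn_ge0.
have [h1 h10 H1] : exists2 h1, 0 < h1 & forall h, 0 < h -> h < h1 ->
    K * (Kl * h) ^+ 2 <= e / 4 * h.
  exists (e / 4 / (K * Kl ^+ 2 + 1)); first by rewrite divr_gt0.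
  move=> h h0; rewrite ltr_pdivlMr// => hh.
  rewrite exprMn mulrA [h ^+ 2]expr2 mulrA ler_wpM2r ?(ltW h0)//.
  by rewrite (le_trans _ (ltW hh))// mulrC ler_wpM2l ?(ltW h0)// lerDl.
have [h2 h20 H2] := cumulative_hazard_derivative hX hlam (divr_gt0 e40 B1).
have [h3 h30 H3] := chain_continuous_Ex hX (divr_gt0 (divr_gt0 e40 B1) K1).
have [_ _ _ [p tp pX]] := hX.
have [h4 h40 H4] := at_right0_ex (transition_function_taylor tp (divr_gt0 e40 d1)).
exists (Num.min (Num.min h1 h2) (Num.min h3 h4)).
  by rewrite !lt_min h10 h20 h30.
move=> u h su h0; rewrite !lt_min => /andP[/andP[hh1 hh2] /andP[hh3 hh4]] uht l i.
have u0 := le_trans s0 su; have uh0 : 0 <= u + h by rewrite addr_ge0// ltW.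
have uuh : u <= u + h by rewrite lerDl ltW.
have suh := le_trans su uuh.
(* [V] is a weight known at time [u], and [D] is its derivative with respect to the cumulative
   hazard. *)
pose V w := W w * psi (Lam u w) l 0.
pose D w := W w * (A *m psi (Lam u w)) l 0.
pose a w := Lam (u + h) w - Lam u w.
pose hz := hazard X lam u.
pose F1 w := W w * psi (Lam (u + h) w) l 0 * X (u + h) w i 0
  - V w * X (u + h) w i 0 - D w * a w * X (u + h) w i 0.
pose F2 w := D w * (a w - h * hz w) * X (u + h) w i 0.
pose F3 w := D w * hz w * (X (u + h) w i 0 - X u w i 0).
have bX j : bounded_rv (fun w => X u w j 0) by exact: (bounded_rv_chain hX).
have bX' : bounded_rv (fun w => X (u + h) w i 0) by exact: (bounded_rv_chain hX).
have ba : bounded_rv a.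
  apply: (@bounded_rv_gen _ _ _ _ _ _ _ hX (u + h) _ (Kl * (u + h - u))) => //.
    by apply: measurable_funB; exact: (gen_measurable_cumulative_hazard hX).
  move=> w; have /andP[a0 a1] := cumulative_hazard_incr hX hlam w u0 uuh.
  by rewrite ger0_norm.
have bhz : bounded_rv hz.
  apply: (@bounded_rv_gen _ _ _ _ _ _ _ hX u _ Kl) => //.
    exact: gen_measurable_hazard.
  by move=> w; exact: (hazard_norm hX).
have bDl : bounded_rv D by exact: bD.
have bVl : bounded_rv V by exact: bV.
have bF1 : bounded_rv F1.
  apply: bounded_rvB; last exact: bounded_rvM (bounded_rvM bDl ba) bX'.
  by apply: bounded_rvB; [exact: bVX|exact: bounded_rvM].
have bahz : bounded_rv (fun w => a w - h * hz w).
  by apply: bounded_rvB => //; apply: bounded_rvM => //; exact: bounded_rv_cst.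
have bF2 : bounded_rv F2 by exact: bounded_rvM (bounded_rvM bDl bahz) bX'.
have bXX : bounded_rv (fun w => X (u + h) w i 0 - X u w i 0) by exact: bounded_rvB.
have bF3 : bounded_rv F3 by exact: bounded_rvM (bounded_rvM bDl bhz) bXX.
have bDX : bounded_rv (fun w => D w * X u w i 0) by exact: bounded_rvM.
have bVX' : bounded_rv (fun w => V w * X (u + h) w i 0) by exact: bounded_rvM.
(* This relies on hazard * X_i = lam_i * X_i, as X takes values in the
   standard basis. *)
have dec : weighted_mean (u + h) l i = Ex P F1 + Ex P F2 + h * Ex P F3 +
    h * lam i 0 * Ex P (fun w => D w * X u w i 0) + Ex P (fun w => V w * X (u + h) w i 0).
  rewrite -(ExZl P h bF3) -(ExZl P (h * lam i 0) bDX).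
  have bh f : bounded_rv f -> forall c : R, bounded_rv (fun w => c * f w).
    by move=> bf c; apply: bounded_rvM => //; exact: bounded_rv_cst.
  have b12 := bounded_rvD bF1 bF2; have b123 := bounded_rvD b12 (bh _ bF3 h).
  have b1234 := bounded_rvD b123 (bh _ bDX (h * lam i 0)).
  rewrite -ExD// -ExD//; last exact: bh.
  rewrite -ExD//; last exact: bh.
  rewrite -ExD//; congr Ex; apply/funext => w.
  rewrite /F1 /F2 /F3 -/(V w).
  have := hazard_chain lam hX w i u0; rewrite -/hz => hzX.
  rewrite -[h * lam i 0 * _]mulrA [lam i 0 * (_ * _)]mulrCA -hzX; ring.
have AD : Ex P (fun w => D w * X u w i 0) = \sum_m A l m * weighted_mean u m i.
  rewrite /weighted_mean; under [RHS]eq_bigr do rewrite -(ExZl P (A l _) (bVX _ _ su)).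
  rewrite -Ex_sum; last first.
    by move=> m; apply: bounded_rvM; [exact: bounded_rv_cst|exact: bVX].
  congr Ex; apply/funext => w; rewrite /D mxE mulr_sumr mulr_suml.
  by apply: eq_bigr => m _; ring.
(* The Markov property at time [u], tested against [V], which is known then and lies in [[0, 1]]. *)
have EV : Ex P (fun w => V w * X (u + h) w i 0) = \sum_j p h i j * weighted_mean u l j.
  have := pX u (u + h) i u0 uuh; rewrite addrAC subrr add0r => cXp.
  have bpX : bounded_rv (fun w => (p h *m X u w) i 0).
    under eq_fun do rewrite mxE.
    by apply: bounded_rv_sum => j; apply: bounded_rvM => //; exact: bounded_rv_cst.
  rewrite (cond_expectation_mul cXp)//; last 2 first.
  - by apply: gen_measurable_gen; exact: mV.
  - by move=> w; exact: V01.
  rewrite /weighted_mean; under [RHS]eq_bigr do rewrite -(ExZl P (p h i _) (bVX _ _ su)).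
  rewrite -Ex_sum; last first.
    by move=> j; apply: bounded_rvM; [exact: bounded_rv_cst|exact: bVX].
  congr Ex; apply/funext => w; rewrite mxE mulr_sumr.
  by apply: eq_bigr => j _; rewrite /V; ring.
have E3 : `|\sum_j (p h i j - (i == j)%:R - h * Q i j) * weighted_mean u l j| <= e / 4 * h.
  rewrite (le_trans (ler_norm_sum _ _ _))//.
  apply: (@le_trans _ _ (\sum_(j < d) e / 4 / (d%:R + 1) * h)).
    apply: ler_sum => j _; rewrite normrM -[leRHS]mulr1.
    by rewrite ler_pM// ?weighted_mean_le//; exact: (H4 h h0 hh4 (i, j)).
  rewrite sumr_const card_ord -[leLHS]mulr_natr mulrAC ler_wpM2r ?(ltW h0)//.
  by rewrite mulrAC ler_pdivrMr// ler_wpM2l ?(ltW e40)// lerDl.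
have E1 : `|Ex P F1| <= e / 4 * h.
  rewrite (le_trans _ (H1 h h0 hh1))//; apply: Ex_norm_le_cst => // w.
  have /andP[W0 W1] := W01 w.
  have -> : F1 w = W w * X (u + h) w i 0 *
      (psi (Lam (u + h) w) - euler_step A (a w) (psi (Lam u w))) l 0.
    by rewrite /F1 /V /D /euler_step !mxE; ring.
  rewrite normrM -[leRHS]mul1r; apply: ler_pM => //.
    by rewrite normrM mulr_ile1 ?(chain_norm hX)// ger0_norm.
  rewrite (le_trans (l1norm_ge _ _))//.
  have /andP[a0 a1] := cumulative_hazard_incr hX hlam w u0 uuh.
  apply: (le_trans (HK _ _ _ _ _)).
  - exact: (cumulative_hazard_ge0 hX).
  - by rewrite -subr_ge0.
  - rewrite (le_trans (cumulative_hazard_le hX hlam w uh0))//.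
    by rewrite ler_wpM2l.
  - rewrite ler_wpM2l// lerXn2r ?nnegrE ?mulr_ge0 ?(ltW h0)//.
    by rewrite (le_trans a1)// addrAC subrr add0r.
have E2 : `|Ex P F2| <= e / 4 * h.
  have := H2 u h u0 (ltW h0) hh2; set N := Ex _ _ => HN.
  have bn := bounded_rv_norm bahz.
  apply: (@le_trans _ _ (B * N)).
    rewrite /N -ExZl//; apply: Ex_norm_le => //.
      by apply: bounded_rvM => //; exact: bounded_rv_cst.
    move=> w; rewrite /F2 normrM -[leRHS]mulr1 ler_pM ?(chain_norm hX)//.
    by rewrite normrM ler_wpM2r// D_le.
  rewrite (le_trans (ler_wpM2l B0 HN))// mulrA ler_wpM2r ?(ltW h0)//.
  by rewrite mulrA ler_pdivrMr// mulrC ler_wpM2l ?(ltW e40)// lerDl.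
have EF3 : `|h * Ex P F3| <= e / 4 * h.
  rewrite normrM (gtr0_norm h0) mulrC ler_wpM2r ?(ltW h0)//.
  have := H3 u h u0 (ltW h0) hh3 i; set N := Ex _ _ => HN.
  have bn := bounded_rv_norm bXX.
  apply: (@le_trans _ _ (B * Kl * N)).
    rewrite /N -ExZl//; apply: Ex_norm_le => //.
      by apply: bounded_rvM => //; exact: bounded_rv_cst.
    move=> w; rewrite /F3 normrM ler_wpM2r// normrM ler_pM// ?D_le//.
    exact: (hazard_norm hX).
  rewrite (le_trans (ler_wpM2l (mulr_ge0 B0 Kl0) HN))//.
  rewrite mulrA ler_pdivrMr// mulrA ler_pdivrMr// mulrC -mulrA.
  rewrite ler_wpM2l ?(ltW e40)// [leRHS]mulrC; apply: ler_pM => //; by rewrite lerDl.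
have -> : weighted_mean (u + h) l i - weighted_mean u l i -
    h * (lam i 0 * (\sum_m A l m * weighted_mean u m i) +
         \sum_j Q i j * weighted_mean u l j) =
    Ex P F1 + Ex P F2 + h * Ex P F3 +
    \sum_j (p h i j - (i == j)%:R - h * Q i j) * weighted_mean u l j.
  under [X in _ = _ + X]eq_bigr do rewrite !mulrBl -[h * Q _ _ * _]mulrA.
  rewrite !sumrB -mulr_sumr dec AD EV.
  have -> : \sum_j (i == j)%:R * weighted_mean u l j = weighted_mean u l i.
    rewrite (bigD1 i)//= eqxx mul1r big1 ?addr0// => j /negPf ji.
    by rewrite eq_sym ji mul0r.
  ring.
rewrite (le_trans (ler_normD _ _))// (le_trans (lerD (ler_normD _ _) (lexx _)))//.
rewrite (le_trans (lerD (lerD (ler_normD _ _) (lexx _)) (lexx _)))//.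
by rewrite (le_trans (lerD (lerD (lerD E1 E2) EF3) E3))// -!mulrDl; lra.
Qed.

Notation QQ := (A *t diag_mx lam^T + 1%:M *t Q).

Definition weighted_vector u : 'cV[R]_(k * d) :=
  \col_x weighted_mean u (mxtens_unindex x).1 (mxtens_unindex x).2.

(** [diag_mx lam^T] makes the default part act within a fixed state [i], and [1%:M] makes the chain
    part act within a fixed count [l]; the result is the drift in [weighted_mean_taylor]. *)
Lemma tens_generator_mulmx u x :
  let l := (mxtens_unindex x).1 in let i := (mxtens_unindex x).2 in
  (QQ *m weighted_vector u) x 0 = lam i 0 * (\sum_m A l m * weighted_mean u m i) +
         \sum_j Q i j * weighted_mean u l j.
Proof.
move=> l i; rewrite mxE.
under eq_bigr do rewrite mxE [(_ *t _) _ _]mxE [(1%:M *t _) _ _]mxE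
   [diag_mx _ _ _]mxE [lam^T _ _]mxE [1%:M _ _]mxE [weighted_vector _ _ _]mxE.
rewrite (@sum_mxtens_unindex R k d (fun m j =>
  (A l m * (lam i 0 *+ (i == j)) + (l == m)%:R * Q i j) * weighted_mean u m j)).
under eq_bigr => m _ do under eq_bigr => j _ do rewrite mulrDl.
under eq_bigr do rewrite big_split/=.
rewrite big_split/=; congr (_ + _).
  rewrite mulr_sumr; apply: eq_bigr => m _.
  rewrite (bigD1 i)//= eqxx mulr1n big1 ?addr0 => [|j /negPf ji]; last first.
    by rewrite eq_sym ji mulr0n mulr0 mul0r.
  ring.
rewrite (bigD1 l)//= [X in _ + X]big1 ?addr0 => [|m /negPf ml]; last first.
  by rewrite big1// => j _; rewrite eq_sym ml !mul0r.
by apply: eq_bigr => j _; rewrite eqxx mul1r.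
Qed.

(** Time is counted from [s] because [W] is known only from then on, so that the expansion is
    available for later times. *)
Lemma weighted_vector_flow t : 0 <= t -> flow QQ t (fun u => weighted_vector (s + u)).
Proof.
move=> t0 e e0; have N0 : 0 < (k * d)%:R + 1 :> R by rewrite ltr_wpDl.
have [h0 h00 H] := weighted_mean_taylor (addr_ge0 s0 t0) (divr_gt0 e0 N0).
exists h0 => // u h u0 h_gt0 hh0 uht.
apply: (@le_trans _ _ (\sum_(x < k * d) e / ((k * d)%:R + 1) * h)).
  apply: ler_sum => x _; rewrite addrA.
  have := H (s + u) h; rewrite lerDl -addrA lerD2l => /(_ u0 h_gt0 hh0 uht).
  move=> /(_ (mxtens_unindex x).1 (mxtens_unindex x).2).
  rewrite -tens_generator_mulmx addrA /euler_step.
  by move: (QQ *m _) => v; rewrite !mxE opprD addrA.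
rewrite sumr_const card_ord -[leLHS]mulr_natr mulrAC ler_wpM2r ?(ltW h_gt0)//.
by rewrite mulrAC ler_pdivrMr// ler_wpM2l ?(ltW e0)// lerDl.
Qed.

Lemma weighted_vectorE t : s <= t ->
  weighted_vector t = expmx ((t - s) *: QQ) *m weighted_vector s.
Proof.
move=> st; have ts : 0 <= t - s by rewrite subr_ge0.
have := flow_unique ts (weighted_vector_flow ts) (expmx_flow QQ (weighted_vector s) 0 ts).
rewrite addr0 addr0 scale0r expmx0 mul1mx add0r => /(_ erefl).
by rewrite addrC subrK.
Qed.

End one_step.

(** * Default times *)

Section survival_weights.
Context (R : realType) (n : nat).

(* Binomial probability that exactly l out of m obligors survive the cumulative
   hazard a. *)
Definition survival_weight (m l : nat) (a : R) : R :=
  'C(m, l)%:R * (expR (- a) ^+ l * (1 - expR (- a)) ^+ (m - l)).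

(** The forward equation of a pure death process: [l] survivors are left at rate [l], and entered
    from [l.+1] survivors at rate [l.+1]. *)
Lemma is_derive_survival_weight m l (a : R) :
  is_derive a (1 : R) (survival_weight m l)
    (- l%:R * survival_weight m l a + l.+1%:R * survival_weight m l.+1 a).
Proof.
pose q (a : R) := expR (- a).
have dq : is_derive a (1 : R) q (- q a).
  have -> : q = expR \o -%R by [].
  by rewrite -mulrN1; apply: is_derive1_comp; exact: is_deriveNid.
have dp : is_derive a (1 : R) (cst 1 - q) (q a).
  by rewrite -[q a in X in is_derive _ _ _ X]opprK -[- - q a]add0r; exact: is_deriveB.
have dl := @is_deriveX _ _ q l a 1 _ dq.
have dml := @is_deriveX _ _ (cst 1 - q) (m - l) a 1 _ dp.
have dM := is_deriveZ 'C(m, l)%:R (is_deriveM dl dml).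
rewrite [X in is_derive _ _ X](_ : survival_weight m l =
    'C(m, l)%:R \*: (q ^+ l * (cst 1 - q) ^+ (m - l))); last first.
  by apply/funext => x; rewrite /survival_weight /= !fctE.
apply: is_derive_eq dM _.
rewrite /survival_weight -/(q a) !fctE.
(* The identity [(l+1) C(m, l+1) = (m - l) C(m, l)] matches the gain term with the derivative of the
   second factor. *)
have -> : l.+1%:R * ('C(m, l.+1)%:R * (q a ^+ l.+1 * (1 - q a) ^+ (m - l.+1))) =
   'C(m, l)%:R * ((m - l)%:R * (q a ^+ l.+1 * (1 - q a) ^+ (m - l).-1)).
  rewrite mulrA -natrM mul_bin_left natrM subnS.
  by rewrite [(m - l)%:R * _]mulrC -mulrA.
rewrite /GRing.scale/= exprS.
case: l {dl dml} => [|l] /=; first by ring.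
by rewrite exprS; ring.
Qed.

(** The weight is one of the nonnegative terms in the binomial expansion of
    [(1 - q + q) ^+ m = 1]. *)
Lemma survival_weight_itv m l (a : R) : 0 <= a -> 0 <= survival_weight m l a <= 1.
Proof.
move=> a0; set q := expR (- a).
have q0 : 0 <= q by exact: expR_ge0.
have q1 : 0 <= 1 - q by rewrite subr_ge0 /q -expR0 ler_expR oppr_le0.
have term0 i : 0 <= 'C(m, i)%:R * (q ^+ i * (1 - q) ^+ (m - i)).
  by rewrite !mulr_ge0// exprn_ge0.
rewrite /survival_weight -/q; apply/andP; split => //.
have [ml|lm] := leqP l m; last by rewrite bin_small// mul0r.
rewrite -[leRHS](_ : (1 - q + q) ^+ m = 1); last by rewrite subrK expr1n.
have ml1 : (l < m.+1)%N by [].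
rewrite [leRHS]exprDn (bigD1 (Ordinal ml1))//=.
rewrite mulr_natl [q ^+ l * _]mulrC lerDl.
by apply: sumr_ge0 => i _; rewrite mulrn_wge0// mulr_ge0// exprn_ge0.
Qed.

(** [m] obligors are at risk and the other [n - m] have already defaulted, so [k] defaults in total
    mean [n - k] survivors among the [m]. *)
Definition survival_vector (m : nat) (a : R) : 'cV[R]_n.+1 :=
  \col_k survival_weight m (n - k) a.

Lemma is_derive_survival_vector m (a : R) k : (m <= n)%N ->
  is_derive a (1 : R) (fun a : R => survival_vector m a k 0)
    ((default_matrix R n *m survival_vector m a) k 0).
Proof.
move=> mn.
have -> : (fun a : R => survival_vector m a k 0) = survival_weight m (n - k).
  by apply/funext => b; rewrite mxE.
apply: is_derive_eq (is_derive_survival_weight m (n - k) a) _.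
rewrite [RHS]mxE (bigD1 k)//= !mxE eqxx; congr (_ + _).
have kn : (k <= n)%N by rewrite -ltnS.
(* At [k = 0] the gain term is the weight of [n.+1] survivors out of [m <= n], which is 0; the
   matrix row has no entry for it either. *)
have [k0|k0] := posnP (k : nat).
  rewrite big1 => [|l lk].
    by rewrite k0 subn0 /survival_weight bin_small ?ltnS// mul0r mulr0.
  by rewrite mxE eq_sym (negPf lk) k0 /= mul0r.
have k1 : (k.-1 < n.+1)%N by rewrite (leq_ltn_trans (leq_pred k)).
rewrite (bigD1 (Ordinal k1))/=; last by rewrite -val_eqE/= neq_ltn prednK// leqnn.
rewrite !mxE -val_eqE/= [k == _ :> nat]eqn_leq [(k <= k.-1)%N]leqNgt prednK// leqnn/=.
rewrite eqxx big1 ?addr0 => [|l /andP[lk lk1]].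
  rewrite addn1; suff -> : (n - k.-1)%N = (n - k).+1 by [].
  by rewrite -subSn// -[in RHS](prednK k0) subSS.
rewrite !mxE eq_sym (negPf lk); case: eqP => [kl|_]; last by rewrite mul0r.
by move: lk1; rewrite -val_eqE/= kl eqxx.
Qed.

End survival_weights.

(** * From a pi-system to the sigma-algebra it generates *)

Section dynkin.
Context (R : realType) (disp : measure_display) (T : measurableType disp).
Variable P : probability T R.

(** The sets where both sides agree form a Dynkin class: complements rely on agreement on the full
    set, which [C] contains, and disjoint unions on countable additivity. *)
Lemma Ex_dynkin (C : set (set T)) (f g : T -> R) : C `<=` measurable ->
  setI_closed C -> C setT -> bounded_rv f -> bounded_rv g ->
  (forall A, C A -> Ex P (fun w => \1_A w * f w) = Ex P (fun w => \1_A w * g w)) ->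
  forall A, <<s C >> A -> Ex P (fun w => \1_A w * f w) = Ex P (fun w => \1_A w * g w).
Proof.
move=> Cm CI CT bf bg fg.
have sCm : <<s C >> `<=` measurable.
  by apply: smallest_sub => //; exact: sigma_algebra_measurable.
have compl (A : set T) h : measurable A -> bounded_rv h ->
    Ex P (fun w => \1_(~` A) w * h w) =
    Ex P (fun w => \1_[set: T] w * h w) - Ex P (fun w => \1_A w * h w).
  move=> mA bh; rewrite -ExB; last 2 first.
  - by apply: bounded_rvM => //; exact: bounded_rv_indic.
  - by apply: bounded_rvM => //; exact: bounded_rv_indic.
  congr Ex; apply/funext => w; rewrite -mulrBl; congr (_ * _).
  by rewrite !indicE in_setT in_setC; case: (w \in A); rewrite ?subrr ?subr0.
have bigcupE (F : (set T)^nat) h : (forall k, measurable (F k)) ->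
    trivIset setT F -> bounded_rv h ->
    (Ex P (fun w => \1_(\bigcup_k F k) w * h w))%:E =
    (\sum_(k <oo) (Ex P (fun w => \1_(F k) w * h w)%R)%:E)%E.
  move=> mF tF bh.
  have mU : measurable (\bigcup_k F k) by exact: bigcup_measurable.
  have ih : P.-integrable (\bigcup_k F k) (EFin \o h).
    exact: integrableS (bounded_rv_integrable P bh).
  rewrite -integral_Ex// (integral_bigcup tF mF ih).
  by apply: eq_eseriesr => k _; rewrite -integral_Ex.
apply: (@dynkin_induction _ (g_sigma_algebraType C)) => //.
- exact: fg.
- by move=> A /sCm mA fgA; rewrite !compl// fgA (fg setT).
- move=> F mF tF fgF; apply: EFin_inj.
  have {}mF k : measurable (F k : set T) by apply: sCm; exact: mF.
  by rewrite !bigcupE//; apply: eq_eseriesr => k _; rewrite fgF.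
Qed.

End dynkin.

(** Complementation turns supersets of [J] into subsets of its complement. In the application these
    complements are sets of survivors, hence the form of the coefficient. *)
Lemma card_supersets (I : finType) (J : {set I}) (k : nat) : (k <= #|I|)%N ->
  #|[set K : {set I} | J \subset K & #|K| == k]%SET| = 'C(#|I| - #|J|, #|I| - k).
Proof.
move=> kI; have -> : (#|I| - #|J|)%N = #|~: J| by rewrite [RHS]cardsCs finset.setCK.
rewrite -cards_draws -(card_imset _ (@finset.setC_inj I)).
apply: eq_card => K; apply/imsetP/idP => [[L + ->]|].
  rewrite !inE => /andP[JL /eqP Lk]; rewrite finset.setCS JL/=.
  by rewrite cardsCs finset.setCK Lk.
rewrite !inE => /andP[KJ /eqP Kk]; exists (~: K); last by rewrite finset.setCK.
by rewrite !inE -finset.setCS finset.setCK KJ cardsCs finset.setCK Kk subKn/=.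
Qed.

(** * Conditioning the default times on the path of the chain *)

Section defaults.
Context (R : realType) (disp : measure_display) (T : measurableType disp).
Variables (P : probability T R) (d n : nat) (X : R -> T -> 'cV[R]_d).
Variables (Q : 'M[R]_d) (lam : 'cV[R]_d) (tau : 'I_n -> T -> \bar R).
Hypothesis hX : is_markov_chain P (natural_filtration X) X Q.
Hypothesis hlam : forall i : 'I_d, 0 <= lam i 0.
Hypothesis tau_meas : forall i, measurable_fun setT (tau i).
Hypothesis tau_indep : cond_independent P (sigma_path X) tau.
Hypothesis tau_law : forall (i : 'I_n) (t : R), 0 <= t ->
  is_cond_prob P (sigma_path X) [set w | (t%:E < tau i w)%E]
    (fun w => expR (- cumulative_hazard X lam t w)).
Implicit Types (s t : R) (w : T).

Notation Lam := (cumulative_hazard X lam).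

Definition defaulted t w : {set 'I_n} := [set i | (tau i w <= t%:E)%E]%SET.

Lemma default_countE t w : default_count tau t w = #|defaulted t w|%:R.
Proof.
rewrite /default_count -sum1_card natr_sum [RHS]big_mkcond/=; apply: eq_bigr => i _.
by rewrite mxE inE; case: ifP.
Qed.

Lemma default_stateE t w k : default_state tau t w k 0 = (#|defaulted t w| == k)%:R.
Proof. by rewrite mxE default_countE eqr_nat. Qed.

Lemma path_events_sub t : 0 <= t ->
  process_events `[0, t] X `<=` process_events `[0, +oo[ X.
Proof.
move=> t0 A [u /= + HA]; rewrite in_itv/= => /andP[u0 _].
by exists u => //=; rewrite in_itv/= u0.
Qed.

Lemma path_events_sub_measurable : process_events `[0, +oo[ X `<=` measurable.
Proof.
move=> A [u /= + HA]; rewrite in_itv/= andbT => u0.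
apply: (process_events_sub_measurable hX u0).
by exists u => //=; rewrite in_itv/= u0 lexx.
Qed.

Lemma gen_measurable_path t (f : T -> R) : 0 <= t -> gen_measurable (process_events `[0, t] X) f ->
  gen_measurable (process_events `[0, +oo[ X) f.
Proof.
move=> t0; apply: gen_measurable_sub => A /(path_events_sub t0) HA.
exact: sub_gen_smallest.
Qed.

Lemma measurable_default i t : measurable [set w : T | (tau i w <= t%:E)%E].
Proof.
have := tau_meas i measurableT (emeasurable_itv `]-oo, t%:E]).
by rewrite setTI; congr measurable; apply/seteqP; split => w /=; rewrite in_itv.
Qed.

Lemma gen_measurable_survival t : 0 <= t ->
  gen_measurable (process_events `[0, t] X) (fun w => expR (- Lam t w)).
Proof.
move=> t0; apply: (@measurableT_comp _ _ _ _ _ _ expR) => //.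
by apply: measurableT_comp => //; exact: (gen_measurable_cumulative_hazard hX).
Qed.

Lemma survival_itv t w : 0 <= t -> 0 <= expR (- Lam t w) <= 1.
Proof.
move=> t0; rewrite expR_ge0/= -expR0 ler_expR oppr_le0.
exact: (cumulative_hazard_ge0 hX).
Qed.

Lemma gen_measurable_default t : 0 <= t ->
  gen_measurable (process_events `[0, t] X) (fun w => 1 - expR (- Lam t w)).
Proof. by move=> t0; apply: measurable_funB => //; exact: gen_measurable_survival. Qed.

Lemma bounded_rv_survival t : 0 <= t -> bounded_rv (fun w => expR (- Lam t w)).
Proof.
move=> t0; apply: (@bounded_rv_gen _ _ _ _ _ _ _ hX t _ 1 t0).
  exact: gen_measurable_survival.
by move=> w; have /andP[? ?] := survival_itv w t0; rewrite ger0_norm.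
Qed.

Lemma is_cond_prob_default i t : 0 <= t ->
  is_cond_prob P (sigma_path X) [set w | (tau i w <= t%:E)%E]
    (fun w => 1 - expR (- Lam t w)).
Proof.
move=> t0; apply: Ex_cond_expectation.
- exact: path_events_sub_measurable.
- exact: bounded_rv_indic (measurable_default i t).
- exact: gen_measurable_path t0 (gen_measurable_default t0).
- exists 1 => w; have /andP[? ?] := survival_itv w t0.
  by rewrite ger0_norm ?subr_ge0// lerBlDr lerDl.
have bs := bounded_rv_survival t0.
have mgt : measurable [set w | (t%:E < tau i w)%E].
  rewrite (_ : [set w | _] = ~` [set w | (tau i w <= t%:E)%E]).
    by apply: measurableC; exact: measurable_default.
  by apply/seteqP; split => w /=; rewrite ltNge => /negP.
have bgt := @bounded_rv_indic R _ _ _ mgt.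
move=> A GA; have bA : bounded_rv (\1_A : T -> R).
  apply: bounded_rv_indic; move: GA; apply: smallest_sub.
    exact: sigma_algebra_measurable.
  exact: path_events_sub_measurable.
transitivity (Ex P (\1_A) - Ex P (fun w => \1_A w * \1_[set w | (t%:E < tau i w)%E] w)).
  rewrite -ExB//; last exact: bounded_rvM.
  congr Ex; apply/funext => w; rewrite -{2}[\1_A w]mulr1 -mulrBr; congr (_ * _).
  rewrite !indicE; have [ti|ti] := leP (tau i w) t%:E.
    by rewrite mem_set// memNset ?subr0//= ltNge ti.
  by rewrite memNset ?mem_set ?subrr//=; apply/negP; rewrite -ltNge.
rewrite (cond_expectation_Ex (tau_law i t0))// -ExB//; last exact: bounded_rvM.
by congr Ex; apply/funext => w; rewrite mulrBr mulr1.
Qed.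

Lemma is_cond_prob_set0 : is_cond_prob P (sigma_path X) set0 (fun _ => 0).
Proof.
apply: Ex_cond_expectation.
- exact: path_events_sub_measurable.
- exact: bounded_rv_indic.
- exact: measurable_cst.
- by exists 0 => w; rewrite normr0.
- by move=> A _; congr Ex; apply/funext => w; rewrite indic0.
Qed.

Section pi_system.
Variables (s : R) (r : 'I_n -> \bar R).
Hypothesis s0 : 0 <= s.
Hypothesis hr : forall i, r i = +oo%E \/ exists2 x, r i = x%:E & 0 <= x <= s.

Let J : {set 'I_n} := [set i | r i != +oo%E]%SET.

(** Conditional probability, given the path, of the constraint on obligor [i]; it is known at time
    [s] because finite [r i] are at most [s]. *)
Let z i w : R := if i \in J then 1 - expR (- Lam (fine (r i)) w) else 1.

Let rJ i : i \in J -> exists2 x, r i = x%:E & 0 <= x <= s.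
Proof. by rewrite inE; case: (hr i) => [->|]. Qed.

Let mz i : gen_measurable (process_events `[0, s] X) (z i).
Proof.
rewrite /z; have [/rJ[x -> /andP[x0 xs]]|_] := boolP (i \in J); last exact: measurable_cst.
apply: gen_measurable_sub (gen_measurable_default x0) => A [u /= + HA].
rewrite in_itv/= => /andP[u0 ux]; apply: sub_gen_smallest.
by exists u => //=; rewrite in_itv/= u0 (le_trans ux).
Qed.

Let z01 i w : 0 <= z i w <= 1.
Proof.
rewrite /z; have [/rJ[x -> /andP[x0 xs]]|_] := boolP (i \in J); last by rewrite ler01 lexx.
have /andP[? ?] := survival_itv w x0.
by rewrite subr_ge0 lerBlDr lerDl; apply/andP.
Qed.

Let bz i : bounded_rv (z i).
Proof.
apply: (@bounded_rv_gen _ _ _ _ _ _ _ hX s _ 1 s0) => // w.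
by have /andP[? ?] := z01 i w; rewrite ger0_norm.
Qed.

Let W (A : set T) w : R := \1_A w * \prod_i z i w.

Let mW A : <<s process_events `[0, s] X >> A ->
  gen_measurable (process_events `[0, s] X) (W A).
Proof.
move=> GA; apply: measurable_funM; first exact: measurable_indic.
by apply: measurable_prod => i _; exact: mz.
Qed.

Let W01 A w : 0 <= W A w <= 1.
Proof.
have /andP[p0 p1] : 0 <= \prod_i z i w <= 1.
  apply: (big_ind (fun x : R => 0 <= x <= 1)) => //; first by rewrite ler01 lexx.
  by move=> x y /andP[x0 x1] /andP[y0 y1]; rewrite mulr_ge0// mulr_ile1.
by rewrite /W indicE; case: (w \in A); rewrite ?mul1r ?mul0r ?p0//= lexx ler01.
Qed.

Section fixed_time.
Variable t : R.
Hypothesis st : s <= t.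

Let t0 : 0 <= t. Proof. exact: le_trans st. Qed.

Let q w := expR (- Lam t w).

(** Intersected over [i], these events say that all constraints hold and that the obligors defaulted
    by [t] are exactly those in [K]. *)
Let c (K : {set 'I_n}) i : set (\bar R) :=
  [set x | (x <= r i)%E] `&`
  (if i \in K then [set x | (x <= t%:E)%E] else [set x | (t%:E < x)%E]).

(** For a constrained obligor [r i <= s <= t]: inside [K] its constraint already implies default by
    [t], so the probability does not depend on [t]; outside [K] the event is empty. *)
Let p (K : {set 'I_n}) i w : R :=
  if i \in J then (if i \in K then z i w else 0)
  else (if i \in K then 1 - q w else q w).

Let mc K i : measurable (c K i).
Proof.
have mle (x : \bar R) : measurable [set y : \bar R | (y <= x)%E].
  have := emeasurable_itv `]-oo, x].
  by congr measurable; apply/seteqP; split => y /=; rewrite in_itv.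
apply: measurableI => //; case: ifP => _ //.
have := emeasurable_itv `]t%:E, +oo[.
by congr measurable; apply/seteqP; split => y /=; rewrite in_itv/= andbT.
Qed.

Let cond_prob_c K i : is_cond_prob P (sigma_path X) (tau i @^-1` c K i) (p K i).
Proof.
rewrite /p; have [iJ|] := boolP (i \in J).
  have [x rx /andP[x0 xs]] := rJ iJ; have xt := le_trans xs st.
  have [iK|iK] /= := boolP (i \in K).
    have -> : z i = fun w => 1 - expR (- Lam x w).
      by apply/funext => w; rewrite /z iJ rx.
    rewrite (_ : _ @^-1` _ = [set w | (tau i w <= x%:E)%E]).
      exact: is_cond_prob_default.
    apply/seteqP; split => w; rewrite /c iK rx /=; [by case|move=> tx].
    by split=> //; rewrite (le_trans tx)// lee_fin.
  rewrite (_ : _ @^-1` _ = set0); first exact: is_cond_prob_set0.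
  apply/seteqP; split => // w; rewrite /c (negPf iK) rx /= => -[tx].
  by rewrite ltNge (le_trans tx)// lee_fin.
rewrite inE negbK => /eqP ri; have [iK|iK] /= := boolP (i \in K).
  rewrite (_ : _ @^-1` _ = [set w | (tau i w <= t%:E)%E]).
    exact: is_cond_prob_default.
  by apply/seteqP; split => w; rewrite /c iK ri /=; [case|rewrite leey].
rewrite (_ : _ @^-1` _ = [set w | (t%:E < tau i w)%E]); first exact: tau_law.
by apply/seteqP; split => w; rewrite /c (negPf iK) ri /=; [case|rewrite leey].
Qed.

Let prod_p K w : \prod_i p K i w = (J \subset K)%:R *
  ((\prod_i z i w) * ((1 - q w) ^+ (#|K| - #|J|) * q w ^+ (n - #|K|))).
Proof.
have [JK|/fintype.subsetPn[i iJ iK]] := boolP (J \subset K); last first.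
  by rewrite mul0r (bigD1 i)//= /p iJ (negPf iK) mul0r.
rewrite mul1r; transitivity ((\prod_i z i w) *
   ((\prod_(i in K :\: J) (1 - q w)) * (\prod_(i in ~: K) q w))).
  rewrite [\prod_(i in K :\: J) _]big_mkcond [\prod_(i in ~: K) _]big_mkcond/=.
  rewrite -!big_split/=; apply: eq_bigr => i _.
  rewrite /p /z !inE; case: (boolP (r i != +oo%E)) => ri /=.
    have -> : i \in K by apply: (fintype.subsetP JK); rewrite inE.
    by rewrite /= !mulr1.
  by case: (i \in K); rewrite /= ?mulr1 ?mul1r.
by rewrite !prodr_const cardsD (finset.setIidPr JK) [#|~: K|]cardsCs finset.setCK card_ord.
Qed.

(** All admissible [K] of size [k] give the same product, so the sum is that product times the
    number of supersets of [J] of size [k]. *)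
Let sum_prod_p (k : 'I_n.+1) w :
  \sum_(K : {set 'I_n} | #|K| == k) \prod_i p K i w =
  (\prod_i z i w) * survival_vector n (n - #|J|) (Lam t w) k 0.
Proof.
transitivity (\sum_(K : {set 'I_n} | #|K| == k) (J \subset K)%:R *
    ((\prod_i z i w) * ((1 - q w) ^+ (k - #|J|) * q w ^+ (n - k)))).
  by apply: eq_bigr => K /eqP Kk; rewrite prod_p Kk.
rewrite -mulr_suml mulrCA; congr (_ * _).
rewrite mxE /survival_weight -/(q w) [q w ^+ _ * _]mulrC.
have kn : (k <= n)%N by rewrite -ltnS.
have := @card_supersets 'I_n J k; rewrite card_ord => /(_ kn) <-.
have -> : \sum_(K : {set 'I_n} | #|K| == k) (J \subset K)%:R =
    #|[set K : {set 'I_n} | J \subset K & #|K| == k]%SET|%:R :> R.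
  rewrite -sum1_card natr_sum big_mkcond [RHS]big_mkcond/=; apply: eq_bigr => K _.
  by rewrite inE andbC; case: (#|K| == k) => //=; case: (J \subset K).
(* If [k < #|J|] no [K] is admissible, and the binomial coefficient, already rewritten as a count,
   vanishes with it. *)
have [Jk|kJ] := leqP #|J| k.
  suff -> : (n - #|J| - (n - k) = k - #|J|)%N by [].
  by rewrite -subnDA addnC subnDA subKn.
rewrite (_ : [set K : {set 'I_n} | _]%SET = finset.set0) ?cards0 ?mul0r//.
apply/setP => K; rewrite !inE; apply/negbTE/negP => /andP[/subset_leq_card JK /eqP Kk].
by move: kJ; rewrite ltnNge -Kk JK.
Qed.

Let bp K i : bounded_rv (p K i).
Proof.
rewrite /p; have [_|_] := boolP (i \in J); have [_|_] //= := boolP (i \in K).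
- exact: bounded_rv_cst.
- by apply: bounded_rvB; [exact: bounded_rv_cst|exact: bounded_rv_survival].
- exact: bounded_rv_survival.
Qed.

(** The left side is split over the possible default sets [K] at time [t]; given the whole path,
    each indicator is replaced by a product of conditional probabilities, which leaves an
    expectation involving [X] alone. *)
Lemma Ex_pi_system A k i : <<s process_events `[0, s] X >> A ->
  Ex P (fun w => \1_(A `&` [set w | forall j, (tau j w <= r j)%E]) w *
                 (default_state tau t w k 0 * X t w i 0)) =
  weighted_mean P X lam (survival_vector n (n - #|J|)) (W A) t k i.
Proof.
move=> GA.
(* [X t w i 0] is itself an indicator and is absorbed into the conditioning event; this is allowed
   although [t] may exceed [s], as the whole path is given. *)
have GA' : sigma_path X (A `&` [set w | X t w i 0 = 1]).
  apply: (@measurableI _ (g_sigma_algebraType (process_events `[0, +oo[ X))).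
    move: GA; apply: smallest_sub; first exact: smallest_sigma_algebra.
    by move=> B /(path_events_sub s0); exact: sub_gen_smallest.
  have := gen_measurable_path t0 (gen_measurable_process i t0 (lexx t)).
  by move=> /(_ measurableT [set 1] (measurable_set1 _)); rewrite setTI.
have mA : measurable A.
  move: GA; apply: smallest_sub; first exact: sigma_algebra_measurable.
  exact: (process_events_sub_measurable hX).
have mA' : measurable (A `&` [set w | X t w i 0 = 1]).
  move: GA'; apply: smallest_sub; first exact: sigma_algebra_measurable.
  exact: path_events_sub_measurable.
have indA w : \1_(A `&` [set w | X t w i 0 = 1]) w = \1_A w * X t w i 0 :> R.
  rewrite indicI /=; congr (_ * _); rewrite indicE.
  have [j Xj] := chain_basis hX w t0.
  have [ij|ij] := eqVneq i j.
    by rewrite mem_set/= Xj mxE ij eqxx.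
  rewrite memNset/= Xj mxE (negPf ij)//=.
  by apply/eqP; rewrite eq_sym oner_eq0.
pose allr : set T := [set w | forall j, (tau j w <= r j)%E].
pose E K := \bigcap_(j in setT) (tau j @^-1` c K j).
have mE K : measurable (E K).
  apply: fin_bigcap_measurable => // j _.
  by have := tau_meas j measurableT (mc K j); rewrite setTI.
have EE K w : \1_(E K) w = \1_allr w * (defaulted t w == K)%:R :> R.
  rewrite indicE [\1_allr w]indicE -natrM mulnb; congr (nat_of_bool _)%:R.
  apply/idP/andP => [|[]]; rewrite inE.
    move=> wE; split; first by rewrite inE => j; have [] := wE j I.
    apply/eqP/setP => j; rewrite inE; have [_] := wE j I.
    by case: ifP => _ /=; [move=> -> | rewrite ltNge => /negbTE ->].
  move=> wr /eqP <-; rewrite inE => j _; split; first exact: wr.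
  by rewrite inE; case: ifPn => //=; rewrite ltNge.
have bAX : bounded_rv (fun w => \1_A w * X t w i 0).
  by apply: bounded_rvM; [exact: bounded_rv_indic|exact: (bounded_rv_chain hX)].
have EK K : Ex P (fun w => \1_A w * X t w i 0 * \1_(E K) w) =
    Ex P (fun w => \1_A w * X t w i 0 * \prod_j p K j w).
  under eq_fun do rewrite -indA; under [in RHS]eq_fun do rewrite -indA.
  have cpK := tau_indep (mc K) (cond_prob_c K).
  apply: (cond_expectation_Ex cpK) => //; first by apply: bounded_rv_indic; exact: mE.
  exact: bounded_rv_prod.
pose sK := [seq K : {set 'I_n} <- index_enum _ | #|K| == k].
transitivity (Ex P (fun w => \sum_(K <- sK) \1_A w * X t w i 0 * \1_(E K) w)).
  congr Ex; apply/funext => w; rewrite default_stateE big_filter.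
  under eq_bigr do rewrite EE mulrA.
  rewrite -mulr_sumr indicI /=.
  have -> : \sum_(K : {set 'I_n} | #|K| == k) (defaulted t w == K)%:R =
      (#|defaulted t w| == k)%:R :> R.
    rewrite big_mkcond (bigD1 (defaulted t w))//= eqxx big1 ?addr0.
      by case: ifP.
    by move=> K; rewrite eq_sym => /negPf ->; case: ifP.
  by rewrite /allr; ring.
rewrite Ex_sum; last first.
  by move=> K; apply: bounded_rvM => //; apply: bounded_rv_indic; exact: mE.
under eq_bigr do rewrite EK.
rewrite -Ex_sum; last first.
  by move=> K; apply: bounded_rvM => //; exact: bounded_rv_prod.
congr Ex; apply/funext => w.
by rewrite big_filter -mulr_sumr sum_prod_p /W; ring.
Qed.

End fixed_time.

Notation QQ := (default_matrix R n *t diag_mx lam^T + 1%:M *t Q).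

Lemma Ex_pi_system_expmx A t x : <<s process_events `[0, s] X >> A -> s <= t ->
  let B := A `&` [set w | forall j, (tau j w <= r j)%E] in
  let zeta t w : 'cV[R]_(n.+1 * d) := default_state tau t w *t X t w in
  Ex P (fun w => \1_B w * zeta t w x 0) =
  (expmx ((t - s) *: QQ) *m \col_y Ex P (fun w => \1_B w * zeta s w y 0)) x 0.
Proof.
move=> GA st B zeta.
have zetaE u y : s <= u -> Ex P (fun w => \1_B w * zeta u w y 0) =
    weighted_vector P X lam (survival_vector n (n - #|J|)) (W A) u y 0.
  move=> su; rewrite mxE -Ex_pi_system//; congr Ex; apply/funext => w.
  congr (_ * _); rewrite mxE; congr (_ * _); congr (fun_of_matrix _ _ _); exact: ord1.
rewrite zetaE// (@weighted_vectorE _ _ _ _ _ _ _ _ hX hlam _ (default_matrix R n)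
  (survival_vector n (n - #|J|)) _ _ s (W A) s0)//.
- by congr (fun_of_matrix (_ *m _) _ _); apply/matrixP => y j; rewrite !ord1 [RHS]mxE zetaE.
- by move=> a l; apply: is_derive_survival_vector; rewrite leq_subr.
- by move=> a l a0; rewrite mxE; exact: survival_weight_itv.
- exact: mW.
Qed.

End pi_system.

End defaults.

(** * The joint process of default count and chain *)

Section joint_chain.
Context (R : realType) (disp : measure_display) (T : measurableType disp).
Variables (P : probability T R) (d n : nat) (X : R -> T -> 'cV[R]_d).
Variables (Q : 'M[R]_d) (lam : 'cV[R]_d) (tau : 'I_n -> T -> \bar R).
Hypothesis hX : is_markov_chain P (natural_filtration X) X Q.
Hypothesis hlam : forall i : 'I_d, 0 <= lam i 0.
Hypothesis tau_meas : forall i, measurable_fun setT (tau i).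
Hypothesis tau_indep : cond_independent P (sigma_path X) tau.
Hypothesis tau_law : forall (i : 'I_n) (t : R), 0 <= t ->
  is_cond_prob P (sigma_path X) [set w | (t%:E < tau i w)%E]
    (fun w => expR (- cumulative_hazard X lam t w)).
Implicit Types (s t : R) (w : T).

Notation QQ := (default_matrix R n *t diag_mx lam^T + 1%:M *t Q).
Notation Y := (default_indicators tau).
Notation events s :=
  (process_events `[0, s] X `|` process_events `[0, s] (default_indicators tau)).

Definition joint_state t w : 'cV[R]_(n.+1 * d) := default_state tau t w *t X t w.

(* r i = +oo puts no constraint on tau i. *)
Definition default_pi_system s : set (set T) :=
  [set B | exists A (r : 'I_n -> \bar R), [/\ <<s process_events `[0, s] X >> A,
    forall i, r i = +oo%E \/ (exists2 x, r i = x%:E & 0 <= x <= s) &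
    B = A `&` [set w | forall j, (tau j w <= r j)%E]]].

Lemma joint_stateE t w y : joint_state t w y 0 =
  default_state tau t w (mxtens_unindex y).1 0 * X t w (mxtens_unindex y).2 0.
Proof.
by rewrite mxE; congr (_ * _); congr (fun_of_matrix _ _ _); exact: ord1.
Qed.

Lemma process_events_default_sub s : process_events `[0, s] Y `<=` measurable.
Proof.
move=> A [u _ [i _ [B mB <-]]].
have -> : (fun w => Y u w i 0) = \1_[set w | (tau i w <= u%:E)%E].
  apply/funext => w; rewrite mxE indicE; congr (nat_of_bool _)%:R.
  by apply/idP/idP; rewrite inE.
exact: (measurable_indic (measurable_default tau_meas i u) measurableT mB).
Qed.

Lemma events_sub_measurable s : 0 <= s -> events s `<=` measurable.
Proof.
move=> s0 A [/(process_events_sub_measurable hX s0)//|].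
exact: process_events_default_sub.
Qed.

Lemma default_pi_system_sub s : 0 <= s -> default_pi_system s `<=` measurable.
Proof.
move=> s0 _ [A [r [GA hr ->]]]; apply: measurableI.
  move: GA; apply: smallest_sub; first exact: sigma_algebra_measurable.
  exact: (process_events_sub_measurable hX).
rewrite (_ : [set w | _] = \bigcap_(j in setT) [set w | (tau j w <= r j)%E]).
  apply: fin_bigcap_measurable => // j _; case: (hr j) => [->|[x -> _]].
    rewrite (_ : [set w | _] = setT)//; apply/seteqP; split => // w _ /=.
    exact: leey.
  exact: measurable_default.
by apply/seteqP; split => [w wr j _|w wr j]; [exact: wr|exact: wr].
Qed.

Lemma default_pi_system_setI s : setI_closed (default_pi_system s).
Proof.
move=> _ _ [A [r [GA hr ->]]] [A' [r' [GA' hr' ->]]].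
exists (A `&` A'), (fun i => Order.min (r i) (r' i)); split.
- exact: (@measurableI _ (g_sigma_algebraType (process_events `[0, s] X))).
- by move=> i; rewrite /Order.min; case: ifP.
- apply/seteqP; split => [w [[wA wr] [wA' wr']]|w [[wA wA'] wr]] /=.
    by split=> // j; rewrite le_min wr wr'.
  by split; split=> // j; have := wr j; rewrite le_min => /andP[].
Qed.

Lemma default_pi_system_setT s : default_pi_system s setT.
Proof.
exists setT, (fun=> +oo%E); split.
- exact: (@measurableT _ (g_sigma_algebraType (process_events `[0, s] X))).
- by left.
- by apply/seteqP; split => // w _; split=> // j; exact: leey.
Qed.

Lemma events_sub_pi_system s : events s `<=` <<s default_pi_system s >>.
Proof.
move=> A [XA|[u us [i _ [B mB <-]]]].
  apply: sub_gen_smallest; exists A, (fun=> +oo%E); split.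
  - exact: sub_gen_smallest.
  - by left.
  - by apply/seteqP; split => [w wA|w []//]; split=> // j; exact: leey.
move: us; rewrite /= in_itv/= => us.
have -> : (fun w => Y u w i 0) = \1_[set w | (tau i w <= u%:E)%E].
  apply/funext => w; rewrite mxE indicE; congr (nat_of_bool _)%:R.
  by apply/idP/idP; rewrite inE.
apply: (@measurable_indic _ (g_sigma_algebraType (default_pi_system s)) R) => //.
apply: sub_gen_smallest.
exists setT, (fun j => if j == i then u%:E else +oo%E); split.
- exact: (@measurableT _ (g_sigma_algebraType (process_events `[0, s] X))).
- by move=> j; case: ifP => _; [right; exists u|left].
- apply/seteqP; split => [w wi|w [_ wr]] /=.
    by split=> // j; case: eqP => [->|_]//; exact: leey.
  by have := wr i; rewrite eqxx.
Qed.

Lemma gen_measurable_joint_state s y : 0 <= s ->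
  gen_measurable (events s) (fun w => joint_state s w y 0).
Proof.
move=> s0; rewrite (_ : (fun _ => _) = fun w =>
  default_state tau s w (mxtens_unindex y).1 0 * X s w (mxtens_unindex y).2 0); last first.
  by apply/funext => w; rewrite joint_stateE.
apply: measurable_funM; last first.
  apply: gen_measurable_sub (gen_measurable_process _ s0 (lexx s)) => A XA.
  by apply: sub_gen_smallest; left.
have mN : gen_measurable (events s) (default_count tau s).
  apply: measurable_sum => i mT B mB; apply: sub_gen_smallest; right.
  by exists s; [rewrite /= in_itv/= s0 lexx|exists i => //; exists B].
rewrite (_ : (fun _ => _) =
    \1_[set w | default_count tau s w = (mxtens_unindex y).1%:R]); last first.
  apply/funext => w; rewrite mxE indicE; congr (nat_of_bool _)%:R.
  by apply/eqP/idP; rewrite inE.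
apply: measurable_indic.
by have := mN measurableT [set (mxtens_unindex y).1%:R] (measurable_set1 _); rewrite setTI.
Qed.

Lemma joint_state_norm t w y : 0 <= t -> `|joint_state t w y 0| <= 1.
Proof.
move=> t0; rewrite joint_stateE normrM mulr_ile1 ?(chain_norm hX)//.
by rewrite default_stateE normr_nat lern1 leq_b1.
Qed.

Lemma bounded_rv_joint_state t y : 0 <= t -> bounded_rv (fun w => joint_state t w y 0).
Proof.
move=> t0; split; last by exists 1 => w; exact: joint_state_norm.
apply: gen_measurable_measurable (gen_measurable_joint_state y t0).
exact: events_sub_measurable.
Qed.

(** The defining identity is known on [default_pi_system s]; both members being bounded, [Ex_dynkin]
    extends it to the sigma-algebra at time [s]. *)
Lemma joint_state_cond_expectation s t y : 0 <= s -> s <= t ->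
  is_cond_expectation P (natural_filtration2 X Y s) (fun w => joint_state t w y 0)
    (fun w => (expmx ((t - s) *: QQ) *m joint_state s w) y 0).
Proof.
move=> s0 st; have t0 := le_trans s0 st.
set M := expmx _.
have ME : (fun w => (M *m joint_state s w) y 0) =
    (fun w => \sum_x M y x * joint_state s w x 0).
  by apply/funext => w; rewrite mxE.
have bM : bounded_rv (fun w => (M *m joint_state s w) y 0).
  rewrite ME; apply: bounded_rv_sum => x; apply: bounded_rvM.
    exact: bounded_rv_cst.
  exact: bounded_rv_joint_state.
apply: Ex_cond_expectation.
- exact: events_sub_measurable.
- exact: bounded_rv_joint_state.
- rewrite ME; apply: measurable_sum => x; apply: measurable_funM => //.
  exact: gen_measurable_joint_state.
- by have [_] := bM.
move=> A FA; have {}FA : <<s default_pi_system s >> A.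
  move: FA; apply: smallest_sub; first exact: smallest_sigma_algebra.
  exact: events_sub_pi_system.
apply: (Ex_dynkin (default_pi_system_sub s0) (@default_pi_system_setI s)
  (default_pi_system_setT s) _ bM _ FA); first exact: bounded_rv_joint_state.
move=> B PB; have mB := default_pi_system_sub s0 PB.
have [A' [r [GA hr Br]]] := PB; rewrite Br in mB *.
rewrite (@Ex_pi_system_expmx _ _ _ _ _ _ _ _ _ _ hX hlam tau_meas tau_indep tau_law
  s r s0 hr A' t y GA st) mxE.
under eq_bigr => x _.
  rewrite [X in _ * X]mxE -ExZl.
  over.
  apply: bounded_rvM; first exact: bounded_rv_indic.
  exact: bounded_rv_joint_state.
rewrite -Ex_sum; last first.
  move=> x; apply: bounded_rvM; first exact: bounded_rv_cst.
  apply: bounded_rvM; first exact: bounded_rv_indic.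
  exact: bounded_rv_joint_state.
congr Ex; apply/funext => w; rewrite mxE mulr_sumr.
by apply: eq_bigr => x _; rewrite mulrCA.
Qed.

Lemma default_state_basis t w : exists k, default_state tau t w = delta_mx k 0.
Proof.
have kn : (#|defaulted tau t w| < n.+1)%N.
  by rewrite ltnS -[X in (_ <= X)%N]card_ord max_card.
exists (Ordinal kn); apply/matrixP => k j; rewrite ord1 default_stateE mxE andbT.
by rewrite eq_sym.
Qed.

Lemma joint_state_basis t w : 0 <= t ->
  exists y : 'I_(n.+1 * d), joint_state t w = delta_mx y 0.
Proof.
move=> t0; have [k Nk] := default_state_basis t w; have [i Xi] := chain_basis hX w t0.
exists (mxtens_index (k, i)); apply/matrixP => y j; rewrite ord1 joint_stateE Nk Xi !mxE.
rewrite !andbT -natrM mulnb; congr (nat_of_bool _)%:R.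
case: (mxtens_indexP y) => k' i'; rewrite mxtens_indexK /=.
by rewrite (can_eq (@mxtens_indexK _ _)) xpair_eqE.
Qed.

(** Eventual equality rather than convergence, because [default_state] tests the count for equality
    and is not continuous in the indicators. *)
Lemma default_indicators_right t w : \forall u \near t^'+, Y u w = Y t w.
Proof.
have : \forall u \near t^'+, forall i : 'I_n, (tau i w <= u%:E)%E = (tau i w <= t%:E)%E.
  apply: filter_forall => i; case: (tau i w) => [x| |].
  - have [xt|tx] := leP x t.
      near=> u; rewrite !lee_fin xt; apply: (le_trans xt); apply: ltW.
      by near: u; exact: nbhs_right_gt.
    near=> u; rewrite !lee_fin [(x <= t)%R]leNgt tx/= leNgt; apply/negbTE/negPn.
    by near: u; exact: nbhs_right_lt.
  - by apply: nearW => u; rewrite !leye_eq.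
  - by apply: nearW => u; rewrite !leNye.
apply: filterS => u tu; apply/matrixP => i j; by rewrite !mxE tu.
Unshelve. all: by end_near. Qed.

(** Just before [t], a default occurring at [t] is not yet counted, hence the strict inequality in
    the limit. *)
Lemma default_indicators_left t w : exists c, \forall u \near t^'-, Y u w = c.
Proof.
exists (\col_i (tau i w < t%:E)%E%:R).
have : \forall u \near t^'-, forall i : 'I_n, (tau i w <= u%:E)%E = (tau i w < t%:E)%E.
  apply: filter_forall => i; case: (tau i w) => [x| |].
  - have [xt|tx] := ltP x t.
      near=> u; rewrite lee_fin lte_fin xt; apply: ltW.
      by near: u; exact: nbhs_left_gt.
    near=> u; rewrite lee_fin lte_fin [(x < t)%R]ltNge tx/= leNgt; apply/negbTE/negPn.
    by apply: lt_le_trans tx; near: u; exact: nbhs_left_lt.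
  - by apply: nearW => u; rewrite leye_eq ltNge leey.
  - by apply: nearW => u; rewrite leNye ltNyr.
apply: filterS => u tu; apply/matrixP => i j; by rewrite !mxE tu.
Unshelve. all: by end_near. Qed.

(** The filter is arbitrary so as to serve both right continuity and left limits. *)
Lemma joint_state_cvg (G : set_system R) (FG : ProperFilter G) w (c : 'cV[R]_n) (L : 'cV[R]_d) :
  (\forall u \near G, Y u w = c) -> X u w @[u --> G] --> L ->
  joint_state u w @[u --> G] -->
    ((\col_k ((\sum_i c i 0) == k%:R)%:R : 'cV[R]_n.+1) *t L : 'cV[R]_(n.+1 * d)).
Proof.
move=> Yc XL; apply: cvg_mx => y j; rewrite ord1.
pose b : R := ((\sum_i c i 0) == (mxtens_unindex y).1%:R)%:R.
rewrite [X in _ --> X](_ : _ = b * L (mxtens_unindex y).2 0); last first.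
  by rewrite !mxE; congr (_ * _); congr (fun_of_matrix _ _ _); exact: ord1.
have XLi : X u w (mxtens_unindex y).2 0 @[u --> G] --> L (mxtens_unindex y).2 0.
  apply: (@cvg_comp _ _ _ (X^~ w) (fun M : 'cV[R]_d => M _ 0) _ _ _ XL).
  exact: coord_continuous.
have : b * X u w (mxtens_unindex y).2 0 @[u --> G] --> b * L (mxtens_unindex y).2 0.
  by apply: cvgMr; exact: XLi.
apply: cvg_trans; apply: near_eq_cvg; apply: filterS Yc => u Yu.
by rewrite joint_stateE mxE /default_count Yu /b.
Qed.

(** For [i != j] and small [h > 0], [0 <= p h i j <= h * (q i j + e)]. *)
Lemma markov_intensity_ge0 (q : 'M[R]_d) p : transition_function p q ->
  forall i j, i != j -> 0 <= q i j.
Proof.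
move=> tp i j ij; have [p0 _ _ _ _] := tp; apply/ler_addgt0Pl => e e0.
have [h0 h00 H] := at_right0_ex (transition_function_taylor tp e0).
have h2 : 0 < h0 / 2 by rewrite divr_gt0.
have := H (h0 / 2) h2; rewrite ltr_pdivrMr// ltr_pMr// ltr1n => /(_ isT (i, j)) /=.
rewrite (negPf ij) subr0 ler_norml => /andP[_].
rewrite lerBlDr => /(le_trans (p0 _ i j (ltW h2))).
by rewrite [_ / 2 * q i j]mulrC -mulrDl pmulr_lge0.
Qed.

(** The columns of [p h] and of the identity both sum to 1, so only the [d] expansion errors remain;
    each gets the share [e / (d%:R + 1)]. *)
Lemma markov_intensity_sum0 (q : 'M[R]_d) p : transition_function p q ->
  forall j, \sum_i q i j = 0.
Proof.
move=> tp j; have [_ p1 _ _ _] := tp.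
apply/eqP; rewrite -normr_eq0 eq_le normr_ge0 andbT; apply/ler_addgt0Pl => e e0.
rewrite addr0; have d1 : 0 < d%:R + 1 :> R by rewrite ltr_wpDl.
have [h0 h00 H] := at_right0_ex (transition_function_taylor tp (divr_gt0 e0 d1)).
have h2 : 0 < h0 / 2 by rewrite divr_gt0.
have {}H i : `|p (h0 / 2) i j - (i == j)%:R - h0 / 2 * q i j| <= e / (d%:R + 1) * (h0 / 2).
  have := H (h0 / 2) h2; rewrite ltr_pdivrMr// ltr_pMr// ltr1n.
  by move=> /(_ isT (i, j)).
rewrite -(ler_pM2l h2) -{1}(gtr0_norm h2) -normrM mulr_sumr.
have -> : \sum_i h0 / 2 * q i j =
    - \sum_i (p (h0 / 2) i j - (i == j)%:R - h0 / 2 * q i j).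
  have -> : \sum_i (p (h0 / 2) i j - (i == j)%:R - h0 / 2 * q i j) =
      \sum_i p (h0 / 2) i j - \sum_i (i == j)%:R - \sum_i h0 / 2 * q i j.
    by rewrite !sumrB.
  have -> : \sum_i (i == j)%:R = 1 :> R.
    by rewrite (bigD1 j)//= eqxx big1 ?addr0// => i /negPf ->.
  by rewrite p1 ?(ltW h2)// subrr sub0r opprK.
rewrite normrN (le_trans (ler_norm_sum _ _ _))//.
apply: (@le_trans _ _ (\sum_(i < d) e / (d%:R + 1) * (h0 / 2))); first exact: ler_sum.
rewrite sumr_const card_ord -[leLHS]mulr_natr mulrAC [leRHS]mulrC ler_wpM2r ?(ltW h2)//.
by rewrite mulrAC ler_pdivrMr// ler_wpM2l ?(ltW e0)// lerDl.
Qed.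

(** The count leaves [l] at rate [n - l] and only towards [l.+1]; the last column is zero since
    every obligor has then defaulted. *)
Lemma default_matrix_sum0 (l : 'I_n.+1) : \sum_k default_matrix R n k l = 0.
Proof.
have ln : (l <= n)%N by rewrite -ltnS.
rewrite (bigD1 l)//= mxE eqxx; have [ln1|nl] := ltnP l n; last first.
  rewrite big1 => [|k kl]; first by have -> : (n - l = 0)%N; [apply/eqP|rewrite oppr0 addr0].
  rewrite mxE (negPf kl); case: eqP => // kl1.
  by have := ltn_ord k; rewrite kl1 ltnS ltnNge nl.
have l1 : (l.+1 < n.+1)%N by [].
rewrite (bigD1 (Ordinal l1))/=; last by rewrite -val_eqE/= gtn_eqF.
rewrite big1 ?addr0 => [|k /andP[kl kl1]].
  by rewrite mxE -val_eqE/= gtn_eqF// eqxx addn1 -subSn// subSS addNr.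
rewrite mxE (negPf kl); case: eqP => // kl2.
by move: kl1; rewrite -val_eqE/= kl2 eqxx.
Qed.

(** Distinct index pairs differ in the count, where the [Q] part vanishes, or only in the chain
    state, where the diagonal matrix does; so each off-diagonal entry comes from one part. Column
    sums vanish because those of [default_matrix] and [Q] do. *)
Lemma joint_transition_function :
  transition_function (fun t : R => expmx (t *: QQ)) QQ.
Proof.
have [_ _ _ [p tp _]] := hX.
have Q0 := markov_intensity_ge0 tp; have Q1 := markov_intensity_sum0 tp.
have QQE x y : QQ x y = default_matrix R n (mxtens_unindex x).1 (mxtens_unindex y).1 *
    (lam (mxtens_unindex x).2 0 *+ ((mxtens_unindex x).2 == (mxtens_unindex y).2)) +
    ((mxtens_unindex x).1 == (mxtens_unindex y).1)%:R *
    Q (mxtens_unindex x).2 (mxtens_unindex y).2.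
  rewrite mxE [(_ *t _) _ _]mxE [(1%:M *t _) _ _]mxE.
  by rewrite [diag_mx _ _ _]mxE [lam^T _ _]mxE [1%:M _ _]mxE.
apply: transition_function_expmx => [x y xy|y].
  rewrite QQE; case: (mxtens_indexP x) xy => k i; case: (mxtens_indexP y) => l j.
  rewrite !mxtens_indexK (can_eq (@mxtens_indexK _ _)) xpair_eqE negb_and /=.
  have [<-|kl] := eqVneq k l => /= [ij|_].
    by rewrite (negPf ij) mulr0n mulr0 add0r mul1r Q0.
  rewrite mul0r addr0 mulr_ge0 ?mulrn_wge0// mxE (negPf kl).
  by case: ifP.
under eq_bigr do rewrite QQE.
rewrite (@sum_mxtens_unindex R n.+1 d (fun k i =>
  default_matrix R n k (mxtens_unindex y).1 * (lam i 0 *+ (i == (mxtens_unindex y).2)) +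
  (k == (mxtens_unindex y).1)%:R * Q i (mxtens_unindex y).2)).
set l := (mxtens_unindex y).1; set j := (mxtens_unindex y).2.
have A1 : \sum_k default_matrix R n k l = 0 := default_matrix_sum0 l.
under eq_bigr do rewrite big_split/= -!mulr_sumr Q1 mulr0 addr0.
by rewrite -mulr_suml A1 mul0r.
Qed.

End joint_chain.

Theorem proposition2p3 (R : realType) (disp : measure_display)
    (T : measurableType disp) (P : probability T R) (d n : nat)
    (X : R -> T -> 'cV[R]_d) (Q : 'M[R]_d) (lam : 'cV[R]_d)
    (tau : 'I_n -> T -> \bar R)
    (hX : is_markov_chain P (natural_filtration X) X Q)
    (hQ : irreducible_intensity Q)
    (hlam : forall i : 'I_d, 0 <= lam i 0)
    (tau_meas : forall i, measurable_fun setT (tau i))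
    (tau_ge0 : forall i w, (0 <= tau i w)%E)
    (tau_indep : cond_independent P (sigma_path X) tau)
    (tau_law : forall (i : 'I_n) (t : R), 0 <= t ->
       is_cond_prob P (sigma_path X) [set w | (t%:E < tau i w)%E]
         (fun w => expR (- \int[lebesgue_measure]_(s in `[0, t])
                             ((lam^T *m X s w) 0 0)))) :
  let F := natural_filtration2 X (default_indicators tau) in
  let zeta := fun (t : R) (w : T) =>
    (default_state tau t w *t X t w : 'cV[R]_(n.+1 * d)) in
  let QQ : 'M[R]_(n.+1 * d) :=
    default_matrix R n *t diag_mx lam^T + 1%:M *t Q in
  is_markov_chain P F zeta QQ /\
  (forall (s t : R) (i : 'I_(n.+1 * d)), 0 <= s -> s <= t ->
     is_cond_expectation P (F s) (fun w => zeta t w i 0)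
       (fun w => (expmx ((t - s) *: QQ) *m zeta s w) i 0)).
Proof.
move=> F zeta QQ.
have ce (s t : R) (i : 'I_(n.+1 * d)) : 0 <= s -> s <= t ->
    is_cond_expectation P (F s) (fun w => zeta t w i 0)
      (fun w => (expmx ((t - s) *: QQ) *m zeta s w) i 0).
  (* The integral in [tau_law] is [cumulative_hazard] up to unfolding. *)
  exact: joint_state_cond_expectation.
split=> //; split.
- by move=> t w t0; exact: (joint_state_basis tau hX).
- move=> t w t0; have [_ /(_ t w t0) Xrc _ _] := hX.
  exact: (joint_state_cvg _ (default_indicators_right tau t w) Xrc).
- move=> t w t0; have [_ _ /(_ t w t0) /cvg_ex[/= L XL] _] := hX.
  have [c Yc] := default_indicators_left tau t w.
  by apply/cvg_ex; eexists; exact: (joint_state_cvg _ Yc XL).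
(* With the exponential semigroup as witness, the Markov property is the conditional expectation
   already obtained. *)
- exists (fun t : R => expmx (t *: QQ)) => //.
  exact: (joint_transition_function n hX hlam).
Qed.
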